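(* The sets $C_q^s(3,2)$ and $C_{qc}^s(3,2)$ coincide. Consequently $C_q^s(3,2)$ is closed.
   Context: $[n]=\{0,1,\dots,n-1\}$. All C*-algebras are unital. A projection is an element $P$ with $P=P^*=P^2$. A projection-valued measure in a C*-algebra is a family $\{P_i\}_{i\in[m]}$ of projections with $\sum_{i\in[m]}P_i=I$. A state on a C*-algebra $\mathfrak{A}$ is a linear map $\phi:\mathfrak{A}\to\mathbb{C}$ with $\phi(I)=1$ and $\phi(a^*a)\ge0$ for all $a\in\mathfrak{A}$. For positive integers $n,m$, $C_{qc}(n,m)\subseteq\mathbb{R}^{n^2m^2}$ is the set of tensors $\{p(i,j|x,y)\}_{x,y\in[n],\,i,j\in[m]}$ for which there exist a C*-algebra $\mathfrak{A}$, projection-valued measures $\{E_{x,i}\}_{i\in[m]}$ ($x\in[n]$) and $\{F_{y,j}\}_{j\in[m]}$ ($y\in[n]$) in $\mathfrak{A}$ with $E_{x,i}F_{y,j}=F_{y,j}E_{x,i}$ for all $x,y,i,j$, and a state $\phi$ on $\mathfrak{A}$ such that $p(i,j|x,y)=\phi(E_{x,i}F_{y,j})$. $C_q(n,m)$ is the set of those $p\in C_{qc}(n,m)$ arising in this way from a finite-dimensional C*-algebra $\mathfrak{A}$. A correlation $p$ is synchronous if $p(i,j|x,x)=0$ for all $x\in[n]$ whenever $i\ne j$. For $r\in\{q,qc\}$, $C_r^s(n,m)$ is the set of synchronous elements of $C_r(n,m)$. Here $n=3$ and $m=2$, and closedness is in $\mathbb{R}^{n^2m^2}$. *)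

(* Defs.v *)
From HB Require Import structures.
From mathcomp Require Import all_boot all_order all_algebra.
From mathcomp Require Import complex.
From mathcomp Require Import all_classical all_reals topology normedtype.

Set Implicit Arguments.
Unset Strict Implicit.
Unset Printing Implicit Defensive.

Import Order.TTheory GRing.Theory Num.Theory.
Import numFieldNormedType.Exports.

Local Open Scope classical_set_scope.
Local Open Scope ring_scope.

(* The norm is a field of the mixin because Hierarchy Builder cannot join
   [Num.NormedZmodule] with a ring structure outside of the [numDomainType]
   branch. It is real-valued, unlike the norm [`|c| : R[i]] of a scalar, whence
   the real part in [cnormZ]. *)
HB.mixin Record isCStarAlgebra (R : realType) (A : Type)
    & GRing.Algebra R[i] A := {
  star : A -> A;
  cnorm : A -> R;
  starK : forall a, star (star a) = a;
  starD : forall a b, star (a + b) = star a + star b;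
  starZ : forall (c : R[i]) a, star (c *: a) = conjc c *: star a;
  starM : forall a b, star (a * b) = star b * star a;
  cnorm_eq0 : forall a, cnorm a = 0 -> a = 0;
  cnormD : forall a b, cnorm (a + b) <= cnorm a + cnorm b;
  cnormZ : forall (c : R[i]) a, cnorm (c *: a) = complex.Re `|c| * cnorm a;
  cnormM : forall a b, cnorm (a * b) <= cnorm a * cnorm b;
  cnorm_star_mul : forall a, cnorm (star a * a) = cnorm a ^+ 2;
  cnorm_complete : forall u : nat -> A,
    (forall e : R, 0 < e ->
       exists N, forall k l, (N <= k)%N -> (N <= l)%N -> cnorm (u k - u l) < e) ->
    exists a, cnorm (u k - a) @[k --> \oo] --> (0 : R)
}.

(* Algebras are nonzero here; this is harmless, as the zero algebra has no
   state. *)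
#[short(type="cstarAlgType")]
HB.structure Definition CStarAlgebra (R : realType) :=
  { A of GRing.Algebra R[i] A & isCStarAlgebra R A }.

Section CStarNotions.
Variables (R : realType) (A : cstarAlgType R).

Definition is_projection (P : A) : Prop := P = star P /\ P = P ^+ 2.

Definition is_pvm (m : nat) (P : 'I_m -> A) : Prop :=
  (forall i, is_projection (P i)) /\ \sum_(i < m) P i = 1.

Definition is_state (phi : {scalar A}) : Prop :=
  phi 1 = 1 /\ forall a : A, 0 <= phi (star a * a).

Definition finite_dimensional : Prop :=
  exists (d : nat) (e : 'I_d -> A),
    forall a : A, exists c : 'I_d -> R[i], a = \sum_(k < d) c k *: e k.

End CStarNotions.

Section Correlations.
Variables (R : realType) (n m : nat).

(* The space R^(n^2 m^2) with its product topology; [p (i, j, x, y)] stands for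
   p(i,j|x,y). *)
Definition tensor : Type := {ptws 'I_m * 'I_m * 'I_n * 'I_n -> R}.
HB.instance Definition _ := Topological.on tensor.

Definition realized_in (A : cstarAlgType R) (p : tensor) : Prop :=
  exists (E F : 'I_n -> 'I_m -> A) (phi : {scalar A}),
    [/\ forall x, is_pvm (E x),
        forall y, is_pvm (F y),
        forall x y i j, E x i * F y j = F y j * E x i,
        is_state phi
      & forall x y i j, (p (i, j, x, y))%:C%C = phi (E x i * F y j)].

Definition C_qc : set tensor :=
  [set p | exists A : cstarAlgType R, realized_in A p].

Definition C_q : set tensor :=
  [set p | exists2 A : cstarAlgType R, finite_dimensional A & realized_in A p].

Definition synchronous : set tensor :=
  [set p | forall x i j, i != j -> p (i, j, x, x) = 0].

Definition C_qc_s : set tensor := C_qc `&` synchronous.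
Definition C_q_s : set tensor := C_q `&` synchronous.

End Correlations.

Arguments C_qc R n m : clear implicits.
Arguments C_q R n m : clear implicits.
Arguments C_qc_s R n m : clear implicits.
Arguments C_q_s R n m : clear implicits.

(* Main.v *)
From HB Require Import structures.
Require Import Defs.
From mathcomp Require Import all_boot all_order all_algebra.
From mathcomp Require Import complex zify ring lra.
From mathcomp Require Import all_classical all_reals topology.
From mathcomp Require Import interval_inference normedtype.

Set Implicit Arguments.
Unset Strict Implicit.
Unset Printing Implicit Defensive.

Import Order.TTheory GRing.Theory Num.Theory.
Import numFieldNormedType.Exports.

Local Open Scope classical_set_scope.
Local Open Scope ring_scope.

(** Put u_x = E_{x,0} - E_{x,1} and t = Re phi. Synchronicity forces t to be
    tracial on the algebra generated by the reflections u_1, u_2, u_3 and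
    determines p by the six numbers a_x = t(u_x) and c_xy = t(u_x u_y). The point
    is that the possible values of (a, c) form an explicit compact convex set, the
    convex hull of
    - the eight deterministic points a = s, c = s s^T with s in {1, -1}^3, and
    - the points with a = 0 and c a real 3 x 3 correlation matrix (positive
      semidefinite with unit diagonal).
    [sync_cone] is the cone over this set and [sync_set] the set of correlations
    that it describes. Three facts give the theorem.

    The set is closed, being a continuous image of a compact set of weights and
    Gram matrices ([sync_set_closed]).

    Each of its points comes from a finite-dimensional algebra
    ([sync_set_sub_C_q_s]). A correlation matrix is the Gram matrix of unit vectors
    v_x in R^3, and left and right multiplication by the imaginary quaternions v_x,
    multiplied by i, are commuting families of reflections of C^4 with
    <1, L_x R_y 1> = v_x . v_y. Eight extra diagonal entries carry the
    deterministic points.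

    Each tracial t has its moments in the set ([trace_near_cone]). Two reflections
    u_2, u_3 generate an algebra whose centre contains
    z = (u_2 u_3 + u_3 u_2) / 2, with spectrum in [-1, 1]. Multiply t by the pieces
    b of the Bernstein partition of unity in X = (1 + z) / 2. On a piece divisible
    by X (1 - X) the traces t(u_2 b) and t(u_3 b) vanish, since
    u_2, u_3 anticommute with (u_2 + u_3) (u_2 - u_3), and positivity of
    t(y (1 - e u_1) y b) for y in the span of 1, u_2, u_3 is precisely the
    positivity of the 3 x 3 matrix that remains once deterministic points of total
    weight |t(u_1 b)| have been removed. On the two extreme pieces u_2 is close to
    u_3 or to - u_3, and the moments are those of two commuting reflections. The
    error is governed by the variance of the binomial distribution and tends to 0
    with the mesh, so that closedness concludes. *)

(** * The cone of synchronous moments *)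

Section Cone.
Variable R : realType.
Implicit Types (q x y z : R) (w : bool -> bool -> bool -> R).

(** Positivity of the symmetric matrix with diagonal q and off-diagonal entries
    x (12), y (13), z (23), spelled out as a quadratic form. *)
Definition psd3 q x y z := forall b1 b2 b3 : R,
  0 <= q * (b1 ^+ 2 + b2 ^+ 2 + b3 ^+ 2)
       + 2 * (b1 * b2 * x + b1 * b3 * y + b2 * b3 * z).

Definition bsign (s : bool) : R := if s then 1 else -1.

Definition atom_sum w (f : bool -> bool -> bool -> R) : R :=
  \sum_s1 \sum_s2 \sum_s3 w s1 s2 s3 * f s1 s2 s3.

(** The weight m is the total mass; w weighs the deterministic points and the matrix
    with diagonal q is the part without bias. *)
Definition sync_cone (m a1 a2 a3 c12 c13 c23 : R) : Prop :=
  exists w q n12 n13 n23,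
  [/\ forall s1 s2 s3, 0 <= w s1 s2 s3, psd3 q n12 n13 n23
    & [/\ m = atom_sum w (fun _ _ _ => 1) + q,
          [/\ a1 = atom_sum w (fun s1 _ _ => bsign s1),
              a2 = atom_sum w (fun _ s2 _ => bsign s2)
            & a3 = atom_sum w (fun _ _ s3 => bsign s3)],
          c12 = atom_sum w (fun s1 s2 _ => bsign s1 * bsign s2) + n12,
          c13 = atom_sum w (fun s1 _ s3 => bsign s1 * bsign s3) + n13
        & c23 = atom_sum w (fun _ s2 s3 => bsign s2 * bsign s3) + n23]].

Lemma atom_sumD w w' f :
  atom_sum (fun s1 s2 s3 => w s1 s2 s3 + w' s1 s2 s3) f
  = atom_sum w f + atom_sum w' f.
Proof. by rewrite /atom_sum !big_bool /=; ring. Qed.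

Lemma sync_coneD m a1 a2 a3 c12 c13 c23 m' a1' a2' a3' c12' c13' c23' :
  sync_cone m a1 a2 a3 c12 c13 c23 -> sync_cone m' a1' a2' a3' c12' c13' c23' ->
  sync_cone (m + m') (a1 + a1') (a2 + a2') (a3 + a3')
    (c12 + c12') (c13 + c13') (c23 + c23').
Proof.
move=> [w [q [x [y [z [w0 P [-> [-> -> ->] -> -> ->]]]]]]].
move=> [w' [q' [x' [y' [z' [w0' P' [-> [-> -> ->] -> -> ->]]]]]]].
exists (fun s1 s2 s3 => w s1 s2 s3 + w' s1 s2 s3), (q + q'), (x + x'), (y + y'), (z + z').
split.
- by move=> *; rewrite addr_ge0.
- by move=> b1 b2 b3; have := P b1 b2 b3; have := P' b1 b2 b3; lra.
- by rewrite !atom_sumD; split; [|split| | |]; ring.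
Qed.

(** If u_3 = u_2 or u_3 = - u_2 and u_1, u_2 commute, then the joint spectral
    weights are (m + s_1 a_1 + s_2 a_2 + s_1 s_2 c_12) / 4. *)
Lemma sync_cone_aligned (e : bool) m a1 a2 c12 :
  (forall s1 s2 : bool, 0 <= m + bsign s1 * a1 + bsign s2 * a2 + bsign s1 * bsign s2 * c12) ->
  sync_cone m a1 a2 (bsign e * a2) c12 (bsign e * c12) (bsign e * m).
Proof.
move=> W.
exists (fun s1 s2 s3 => if s3 == (s2 == e) then
   4^-1 * (m + bsign s1 * a1 + bsign s2 * a2 + bsign s1 * bsign s2 * c12) else 0), 0, 0, 0, 0.
split=> [s1 s2 s3||].
- by case: ifP => // _; rewrite mulr_ge0 ?invr_ge0.
- by move=> *; rewrite !(mul0r, mulr0, addr0).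
- by rewrite /atom_sum !big_bool; case: e; rewrite /bsign /=; (split; [|split| | |]; field).
Qed.

(** If u_2 and u_3 have no bias, then that of u_1 can be carried by deterministic
    points with s_1 = e, of total weight e a_1. Within these the four choices of
    (s_2, s_3) are weighed so that c_12 and c_13 receive nothing and c_23 receives
    e a_1 x. *)
Lemma sync_cone_generic (e : bool) m a1 c12 c13 c23 x :
  -1 <= x <= 1 -> 0 <= bsign e * a1 ->
  psd3 (m - bsign e * a1) c12 c13 (c23 - bsign e * a1 * x) ->
  sync_cone m a1 0 0 c12 c13 c23.
Proof.
move=> /andP[x1 x1'] a1e P.
exists (fun s1 s2 s3 => if s1 == e then
  4^-1 * (bsign e * a1) * (1 + bsign s2 * bsign s3 * x) else 0).
exists (m - bsign e * a1), c12, c13, (c23 - bsign e * a1 * x).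
split=> [s1 s2 s3|//|].
- case: ifP => // _; apply: mulr_ge0; first by rewrite mulr_ge0// invr_ge0.
  by case: s2 s3 => [] []; rewrite /bsign /=; lra.
- by rewrite /atom_sum !big_bool; case: e {a1e P}; rewrite /bsign /=; (split; [|split| | |]; field).
Qed.

Lemma psd3_bsign (e : bool) q x y z : psd3 q x y z -> psd3 q (bsign e * x) (bsign e * y) z.
Proof.
move=> P b1 b2 b3; have := P (bsign e * b1) b2 b3.
by case: e; rewrite /bsign /=; lra.
Qed.

End Cone.

(** * Localization by Bernstein polynomials *)

Section Moments.
Variable R : realType.

Definition bern k l : {poly R} := 'X ^+ k * (1 - 'X) ^+ l.

(** What survives of a tracial functional t and three reflections after evaluating
    polynomials at X = (1 + z) / 2: m p = t(p), a_i p = t(u_i p) and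
    c_1j p = t(u_1 u_j p). The correlation of u_2 and u_3 is m ((2X - 1) p).
    [mom_quad] is positivity of t(y (1 - e u_1) y p) for
    y = b_1 - b_2 u_2 - b_3 u_3; the last three fields are Cauchy-Schwarz
    inequalities, freed from square roots by the parameter r. In [mom_a] and
    [mom_c] the right-hand side comes from (u_2 - u_3)^2 = 4 (1 - X) for e = true
    and from (u_2 + u_3)^2 = 4 X for e = false. *)
Record moment_system (m a1 a2 a3 c12 c13 : {scalar {poly R}}) : Prop := {
  mom1 : m 1 = 1;
  mom_sqr : forall k l q, 0 <= m (q ^+ 2 * bern k l);
  mom_quad : forall k l (e : bool) b1 b2 b3,
    0 <= (b1 ^+ 2 + b2 ^+ 2 + b3 ^+ 2) * (m (bern k l) - bsign R e * a1 (bern k l))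
      + 2 * b2 * b3 * (m ((2 * 'X - 1) * bern k l) - bsign R e * a1 ((2 * 'X - 1) * bern k l))
      + 2 * bsign R e * b1 * (b2 * c12 (bern k l) + b3 * c13 (bern k l))
      - 2 * b1 * (b2 * a2 (bern k l) + b3 * a3 (bern k l));
  mom_generic : forall k l, a2 (bern k.+1 l.+1) = 0 /\ a3 (bern k.+1 l.+1) = 0;
  mom_a1 : forall k l q (s : bool) (r : R),
    bsign R s * 2 * r * a1 (q * bern k l) <= r ^+ 2 * m (bern k l) + m (q ^+ 2 * bern k l);
  mom_a : forall k l (e s : bool) (r : R),
    bsign R s * 2 * r * (a2 (bern k l) - bsign R e * a3 (bern k l))
      <= r ^+ 2 * m (bern k l) + 4 * m (bern (k + ~~ e) (l + e));
  mom_c : forall k l (e s : bool) (r : R),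
    bsign R s * 2 * r * (c12 (bern k l) - bsign R e * c13 (bern k l))
      <= r ^+ 2 * m (bern k l) + 4 * m (bern (k + ~~ e) (l + e))
}.

Variables m a1 a2 a3 c12 c13 : {scalar {poly R}}.
Hypothesis M : moment_system m a1 a2 a3 c12 c13.

(** The case y = 1 + s_2 u_2, for which y^2 = 2 y. *)
Lemma mom_commuting k l (s1 s2 : bool) :
  0 <= m (bern k l) + bsign R s1 * a1 (bern k l) + bsign R s2 * a2 (bern k l)
       + bsign R s1 * bsign R s2 * c12 (bern k l).
Proof.
have := mom_quad M k l (~~ s1) 1 (- bsign R s2) 0.
by case: s1 s2 => [] []; rewrite /bsign /=; lra.
Qed.

(** The mass is kept exact, so that the errors of the pieces add up while the total
    mass stays 1. *)
Definition near_cone (p : {poly R}) (eps : R) : Prop :=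
  exists x1 x2 x3 y12 y13 y23,
  [/\ sync_cone (m p) x1 x2 x3 y12 y13 y23,
    [/\ `|x1 - a1 p| <= eps, `|x2 - a2 p| <= eps & `|x3 - a3 p| <= eps],
    `|y12 - c12 p| <= eps, `|y13 - c13 p| <= eps
    & `|y23 - m ((2 * 'X - 1) * p)| <= eps].

Lemma near_coneD p q e1 e2 :
  near_cone p e1 -> near_cone q e2 -> near_cone (p + q) (e1 + e2).
Proof.
move=> [x1 [x2 [x3 [y12 [y13 [y23 [C [h1 h2 h3] h4 h5 h6]]]]]]].
move=> [x1' [x2' [x3' [y12' [y13' [y23' [C' [h1' h2' h3'] h4' h5' h6']]]]]]].
exists (x1 + x1'), (x2 + x2'), (x3 + x3'), (y12 + y12'), (y13 + y13'), (y23 + y23').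
have T (a b c d f g : R) :
    `|a - b| <= f -> `|c - d| <= g -> `|a + c + (- b - d)| <= f + g.
  by move=> h h'; rewrite addrACA (le_trans (ler_normD _ _))// lerD.
by rewrite mulrDr !linearD /=; split;
  [exact: sync_coneD | split; exact: T | exact: T..].
Qed.

Lemma near_cone_le p e1 e2 : e1 <= e2 -> near_cone p e1 -> near_cone p e2.
Proof.
move=> le [x1 [x2 [x3 [y12 [y13 [y23 [C [h1 h2 h3] h4 h5 h6]]]]]]].
exists x1, x2, x3, y12, y13, y23.
by split=> //; [split| | |]; apply: le_trans le.
Qed.

(** The pieces of degree N are obtained from 1 by splitting N times, as the leaves of
    a binary tree: this replaces binomial coefficients by an induction. *)
Lemma bern_split k l : bern k l = bern k.+1 l + bern k l.+1.
Proof. by rewrite /bern !exprS; ring. Qed.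

Lemma m_ge0 k l : 0 <= m (bern k l).
Proof. by have := mom_sqr M k l 1; rewrite expr1n mul1r. Qed.

Lemma norm_le_bsign (x y : R) : (forall s, bsign R s * x <= y) -> `|x| <= y.
Proof.
move=> h; rewrite ler_norml; have := h true; have := h false.
by rewrite /bsign /= => *; apply/andP; split; lra.
Qed.

Lemma norm_a1 k l q (r : R) : 0 < r ->
  `|2 * a1 (q * bern k l)| <= r * m (bern k l) + r^-1 * m (q ^+ 2 * bern k l).
Proof.
move=> r0; apply: norm_le_bsign => s; rewrite -(ler_pM2l r0).
have -> (x y : R) : r * (r * x + r^-1 * y) = r ^+ 2 * x + y.
  by field; rewrite gt_eqF.
have -> (x : R) : r * (bsign R s * (2 * x)) = bsign R s * 2 * r * x by ring.
exact: mom_a1 M _ _ _ _ _.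
Qed.

(** On a piece concentrated near X = x, the number t(u_1 z b) that enters
    [mom_quad] may be replaced by (2 x - 1) t(u_1 b), which is what
    [sync_cone_generic] needs. The price is an error in c_23 alone, controlled by
    the second moment of X - x. *)
Lemma near_cone_generic k l (x r : R) : 0 < r -> 0 <= x <= 1 ->
  near_cone (bern k.+1 l.+1) (r * m (bern k.+1 l.+1)
     + r^-1 * m (('X - x%:P) ^+ 2 * bern k.+1 l.+1)).
Proof.
move=> r0 /andP[x0 x1]; set b := bern _ _.
have [A2 A3] := mom_generic M k l.
(* the sign of the bias of u_1 *)
pose e := 0 <= a1 b.
have ea : 0 <= bsign R e * a1 b.
  by rewrite /e; case: (leP 0 (a1 b)) => /=; rewrite /bsign; lra.
have Z (f : {scalar {poly R}}) : f ((2 * 'X - 1) * b) =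
    (2 * x - 1) * f b + 2 * f (('X - x%:P) * b).
  have -> : (2 * 'X - 1) * b = (2 * x - 1) *: b + 2 *: (('X - x%:P) * b).
    by rewrite -!mul_polyC !rmorphB !rmorphM/= !polyC1 [2%:P]rmorph_nat; ring.
  by rewrite linearP linearZ.
have P : psd3 (m b - bsign R e * a1 b) (c12 b) (c13 b)
      (m ((2 * 'X - 1) * b) - bsign R e * a1 ((2 * 'X - 1) * b)).
  have -> : c12 b = bsign R e * (bsign R e * c12 b) by rewrite /bsign; case: e {ea}; ring.
  have -> : c13 b = bsign R e * (bsign R e * c13 b) by rewrite /bsign; case: e {ea}; ring.
  apply: psd3_bsign => b1 b2 b3; have := mom_quad M k.+1 l.+1 e b1 b2 b3.
  by rewrite -/b A2 A3; lra.
pose d := bsign R e * (2 * a1 (('X - x%:P) * b)).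
have Hd : `|d| <= r * m b + r^-1 * m (('X - x%:P) ^+ 2 * b).
  apply: le_trans (norm_a1 _ _ _ r0); rewrite normrM.
  by rewrite /bsign; case: (e); rewrite ?normrN normr1 mul1r.
have E0 := le_trans (normr_ge0 _) Hd.
exists (a1 b), 0, 0, (c12 b), (c13 b), (m ((2 * 'X - 1) * b) - d).
split; last 4 first.
- by rewrite A2 A3 !subr0 !subrr normr0.
- by rewrite subrr normr0.
- by rewrite subrr normr0.
- by rewrite addrC addKr normrN.
apply: (@sync_cone_generic _ e _ _ _ _ _ (2 * x - 1)) => //; first by apply/andP; split; lra.
by move: P; congr (psd3 _ _ _ _); rewrite (Z a1) /d; ring.
Qed.

(** Replacing u_3 by u_2 (e = true) or by - u_2 (e = false) costs the mass of
    1 - X, respectively X. *)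
Lemma near_cone_aligned k l (e : bool) (r : R) : 0 < r ->
  near_cone (bern k l) (r * m (bern k l) + (2 / r + 2) * m (bern (k + ~~ e) (l + e))).
Proof.
move=> r0; set b := bern k l; set b' := bern (k + _) _.
have b0 : 0 <= m b := m_ge0 _ _.
have b0' : 0 <= m b' := m_ge0 _ _.
have T x : (forall s, bsign R s * 2 * r * x <= r ^+ 2 * m b + 4 * m b') ->
    `|x| <= r * m b + (2 / r + 2) * m b'.
  move=> h; apply: (@le_trans _ _ (2^-1 * (r * m b + 4 * r^-1 * m b'))).
    apply: norm_le_bsign => s; rewrite -(ler_pM2l r0) -(@ler_pM2l _ 2)//.
    apply: le_trans (le_trans (h s) _); rewrite le_eqVlt; apply/orP; left; apply/eqP.
      by ring.
    by field; rewrite gt_eqF.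
  rewrite !mulrDr; have := mulr_ge0 (ltW r0) b0.
  have : 0 <= r^-1 * m b' by rewrite mulr_ge0// invr_ge0 ltW.
  by lra.
have E0 : 0 <= r * m b + (2 / r + 2) * m b'.
  by rewrite addr_ge0// mulr_ge0 ?addr_ge0 ?divr_ge0// ltW.
exists (a1 b), (a2 b), (bsign R e * a2 b), (c12 b), (bsign R e * c12 b), (bsign R e * m b).
have S x y : bsign R e * x - y = bsign R e * (x - bsign R e * y).
  by rewrite /bsign; case: e {b' T b0' E0}; ring.
have N x : `|bsign R e * x| = `|x| by rewrite /bsign; case: (e); rewrite ?mulN1r ?normrN ?mul1r.
split; last 4 first.
- by rewrite !subrr normr0 S N; split=> //; apply: T => s; exact: mom_a M _ _ _ _ _.
- by rewrite subrr normr0.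
- by rewrite S N; apply: T => s; exact: mom_c M _ _ _ _ _.
- have -> : bsign R e * m b - m ((2 * 'X - 1) * b) = bsign R e * (2 * m b').
    rewrite -linearZ -linearB -!linearZ/=; congr (m _).
    rewrite /b /b' /bern; case: e {b' T b0' E0 S N} => /=; rewrite ?addn0 ?addn1 ?exprS -!mul_polyC.
      by rewrite [2%:P]rmorph_nat polyC1; ring.
    by rewrite [2%:P]rmorph_nat polyCN polyC1; ring.
  rewrite N ger0_norm ?mulr_ge0//.
  have := mulr_ge0 (ltW r0) b0.
  have : 0 <= r^-1 * m b' by rewrite mulr_ge0// invr_ge0 ltW.
  by lra.
by apply: sync_cone_aligned => s1 s2; exact: mom_commuting.
Qed.

Lemma mom_amgm k l q (u : R) : 0 < u ->
  2 * m (q * bern k l) <= u * m (bern k l) + u^-1 * m (q ^+ 2 * bern k l).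
Proof.
move=> u0; have := mom_sqr M k l (q - u%:P).
have -> : (q - u%:P) ^+ 2 * bern k l =
    q ^+ 2 * bern k l - (2 * u) *: (q * bern k l) + u ^+ 2 *: bern k l.
  by rewrite -!mul_polyC !rmorphM/= [2%:P]rmorph_nat; ring.
rewrite linearD linearB ![m (_ *: _)]linearZ/= => h.
rewrite -(ler_pM2l u0).
have -> (x y : R) : u * (u * x + u^-1 * y) = u ^+ 2 * x + y.
  by field; rewrite gt_eqF.
by lra.
Qed.

(** The two coefficients bound the error in the generic and in the aligned case
    alike: r absorbs the square root of Cauchy-Schwarz and u turns the first moment
    of X - x into the second. *)
Definition leaf_a (r u : R) := r + (1 / r + 1) * u.
Definition leaf_b (r u : R) := r^-1 + (1 / r + 1) / u.

Lemma near_cone_leaf k l (r u : R) : 0 < r -> 0 < u -> (0 < k + l)%N ->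
  near_cone (bern k l) (leaf_a r u * m (bern k l)
     + leaf_b r u * m (('X - (k%:R / (k + l)%:R)%:P) ^+ 2 * bern k l)).
Proof.
move=> r0 u0 kl0; set b := bern k l; set q := ('X - _).
have b0 : 0 <= m b := m_ge0 _ _.
have q0 : 0 <= m (q ^+ 2 * b) := mom_sqr M _ _ _.
have r'0 : 0 <= r^-1 by rewrite invr_ge0 ltW.
have u'0 : 0 <= u^-1 by rewrite invr_ge0 ltW.
have K0 : 0 <= 1 / r + 1 by rewrite addr_ge0// div1r.
have aligned (e : bool) : bern (k + ~~ e) (l + e) = q * b \/ bern (k + ~~ e) (l + e) = - q * b ->
    near_cone b (leaf_a r u * m b + leaf_b r u * m (q ^+ 2 * b)).
  move=> h; have nb := @near_cone_aligned k l e r r0.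
  apply: near_cone_le nb; rewrite -/b.
  have h' : 2 * m (bern (k + ~~ e) (l + e)) <= u * m b + u^-1 * m (q ^+ 2 * b).
    by case: h => ->; [|rewrite -(sqrrN q)]; exact: mom_amgm.
  have := ler_wpM2l K0 h'.
  have := mulr_ge0 r'0 q0.
  rewrite /leaf_a /leaf_b /=; set x := m b; set y := m (q ^+ 2 * b); set t := m (bern _ _).
  by rewrite !div1r; lra.
have [l0|l0] := posnP l.
  apply: (aligned true); right; rewrite l0 !addn0 add0n.
  rewrite /q /b l0 addn0 divff ?pnatr_eq0 -?lt0n; last by rewrite l0 addn0 in kl0.
  by rewrite /bern polyC1; ring.
have [k0|k0] := posnP k.
  apply: (aligned false); left; rewrite k0 !addn0 add0n.
  by rewrite /q /b k0 mul0r polyC0 /bern; ring.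
apply: near_cone_le (_ : near_cone b (r * m b + r^-1 * m (q ^+ 2 * b))).
  rewrite lerD// ler_wpM2r// /leaf_a /leaf_b lerDl mulr_ge0//; exact: ltW.
rewrite /b /q -(prednK k0) -(prednK l0); apply: near_cone_generic => //.
rewrite divr_ge0//= ler_pdivrMr ?mul1r ?ler_nat ?leq_addr//.
Qed.

(** Each splitting is a trial with probability of success X. After k successes and l
    failures, with d trials left, the final number of successes has conditional
    expectation k + d X, hence the final squared deviation from N X has conditional
    expectation (k - (k + l) X)^2 + d X (1 - X). This is a martingale, which makes
    the induction on d an identity of polynomials. *)
Lemma near_cone_node N d k l (r u : R) : 0 < r -> 0 < u -> (0 < N)%N ->
  (k + l + d)%N = N ->
  near_cone (bern k l) (leaf_a r u * m (bern k l) + leaf_b r u / N%:R ^+ 2 *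
    m (((k%:R - (k + l)%:R * 'X) ^+ 2 + d%:R * ('X * (1 - 'X))) * bern k l)).
Proof.
move=> r0 u0 N0; elim: d k l => [|d IH] k l.
  rewrite addn0 => kl; rewrite mul0r addr0.
  have N1 : N%:R != 0 :> R by rewrite pnatr_eq0 -lt0n.
  apply: near_cone_le (@near_cone_leaf k l r u r0 u0 _); last by rewrite kl.
  rewrite kl lerD2l -mulrA le_eqVlt; apply/orP; left; apply/eqP; congr (_ * _).
  have -> : k%:R - N%:R * 'X = - N%:R *: ('X - (k%:R / N%:R)%:P) :> {poly R}.
    rewrite scalerBr -!mul_polyC -polyCM mulNr [N%:R * (_ / _)]mulrC divfK//.
    by rewrite !polyCN !polyC_natr; ring.
  by rewrite exprZn sqrrN -scalerAl linearZ/= mulKf// expf_eq0.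
move=> kl.
have h1 := IH k.+1 l ltac:(by rewrite -kl; lia).
have h2 := IH k l.+1 ltac:(by rewrite -kl; lia).
rewrite [in near_cone _]bern_split; apply: near_cone_le (near_coneD h1 h2).
rewrite le_eqVlt; apply/orP; left; apply/eqP.
have -> (a b x y z t : R) : a * x + b * y + (a * z + b * t) = a * (x + z) + b * (y + t) by ring.
rewrite -!linearD/=; congr (_ * m _ + _ * m _); first by rewrite -bern_split.
by rewrite /bern !exprS; ring.
Qed.

(** At the root the variance is N X (1 - X), so that the error is of order 1 / N
    after division by N^2. *)
Lemma near_cone1 (eps : R) : 0 < eps -> near_cone 1 eps.
Proof.
move=> e0; pose r := eps / 3; pose u := r / (1 / r + 1).
have r0 : 0 < r by rewrite divr_gt0.
have K0 : 0 < 1 / r + 1 by rewrite addr_gt0// divr_gt0.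
have u0 : 0 < u by rewrite divr_gt0.
have b0 : 0 < leaf_b r u by rewrite addr_gt0 ?invr_gt0// divr_gt0.
have [N HN] : exists N : nat, leaf_b r u / r < N.+1%:R.
  exists (Num.truncn (leaf_b r u / r)); exact: truncnS_gt.
have bern00 : bern 0 0 = 1 by rewrite /bern !expr0 mulr1.
have := @near_cone_node N.+1 N.+1 0 0 r u r0 u0 isT (add0n _).
rewrite bern00 !mulr1 mul0r subrr expr0n add0r (mom1 M) mulr1.
apply: near_cone_le.
have -> : leaf_a r u = 2 * r by rewrite /leaf_a /u mulrC divfK ?gt_eqF//; ring.
have -> : N.+1%:R * ('X * (1 - 'X)) = N.+1%:R *: bern 1 1.
  by rewrite /bern !expr1 scaler_nat mulr_natl.
rewrite linearZ/=.
have bern11 : m (bern 1 1) <= 1.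
  have := m_ge0 2 0; have := m_ge0 0 1; have := mom1 M.
  by rewrite -bern00 (bern_split 0 0) linearD/= (bern_split 1 0) linearD/=; lra.
have N0 : 0 < N.+1%:R :> R by [].
have : leaf_b r u / N.+1%:R < r.
  by rewrite ltr_pdivrMr// mulrC -ltr_pdivrMr.
have cancel_sqr (x y z : R) : 0 < y -> x / y ^+ 2 * (y * z) = x / y * z.
  by move=> y0; field; rewrite gt_eqF.
rewrite cancel_sqr//; move=> h; have : leaf_b r u / N.+1%:R * m (bern 1 1) <= r.
  by rewrite (le_trans _ (ltW h))// ler_piMr// divr_ge0// ltW.
have E : 2 * r + r = eps by rewrite /r; field.
by move=> h2; rewrite -E lerD2l.
Qed.

End Moments.

(** * Tracial functionals and three reflections *)

Local Notation rscale r a := ((r)%:C%C *: a).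

Section Trace.
Variables (R : realType) (A : cstarAlgType R).
Implicit Types (a x y g h : A) (r : R).

Definition real_linear (f : A -> R) :=
  {morph f : a b / a + b} /\ forall r a, f (rscale r a) = r * f a.

(** In the application D consists of the elements that commute with every F_{y,j}
    and against which the state is a trace on the commutant of the F_{y,j}. *)
Record tracial (t : A -> R) (D : A -> Prop) : Prop := {
  tr_lin : real_linear t;
  tr1 : t 1 = 1;
  tr_pos : forall a, 0 <= t (star a * a);
  dom1 : D 1;
  domD : forall a b : A, D a -> D b -> D (a + b);
  domM : forall a b : A, D a -> D b -> D (a * b);
  domZ : forall r a, D a -> D (rscale r a);
  dom_star : forall a, D a -> D (star a);
  trC : forall a b : A, D a -> D b -> t (a * b) = t (b * a)
}.

Definition reflection (u : A) := star u = u /\ u * u = 1.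

Variables (t : A -> R) (D : A -> Prop) (T : tracial t D).
Variables u1 u2 u3 : A.
Hypotheses (D1 : D u1) (D2 : D u2) (D3 : D u3).
Hypotheses (U1 : reflection u1) (U2 : reflection u2) (U3 : reflection u3).

Lemma rscale1 a : rscale 1 a = a. Proof. by rewrite scale1r. Qed.
Lemma rscaleA r r' a : rscale r (rscale r' a) = rscale (r * r') a.
Proof. by rewrite scalerA -rmorphM. Qed.

Lemma rscaleAl r a (b : A) : rscale r a * b = rscale r (a * b).
Proof. by rewrite -scalerAl. Qed.

Lemma rscaleAr r a (b : A) : a * rscale r b = rscale r (a * b).
Proof. by rewrite -scalerAr. Qed.

Lemma rscaleN1 a : rscale (-1) a = - a.
Proof. by rewrite (rmorphN (real_complex R)) rmorph1 scaleN1r. Qed.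

Lemma star_rscale r a : star (rscale r a) = rscale r (star a).
Proof. by rewrite starZ /= oppr0. Qed.

Lemma star1 : star (1 : A) = 1.
Proof. by rewrite -[LHS]mulr1 -{2}(starK 1) -starM mulr1 starK. Qed.

Lemma domN a : D a -> D (- a).
Proof. by move=> Da; rewrite -rscaleN1; exact: (domZ T). Qed.

Lemma domB a (b : A) : D a -> D b -> D (a - b).
Proof. by move=> Da Db; apply: (domD T) => //; exact: domN. Qed.

Lemma real_linearN f a : real_linear f -> f (- a) = - f a.
Proof. by case=> _ fZ; rewrite -rscaleN1 fZ mulN1r. Qed.

Lemma real_linearB f a (b : A) : real_linear f -> f (a - b) = f a - f b.
Proof. by move=> F; rewrite F.1 real_linearN. Qed.

Lemma real_linear_mul g (b : A) : real_linear (fun a => t (g * a * b)).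
Proof.
split=> [a c|r a]; first by rewrite mulrDr mulrDl (tr_lin T).1.
by rewrite rscaleAr rscaleAl (tr_lin T).2.
Qed.

Definition lin3 (b1 b2 b3 : R) : A := rscale b1 1 + rscale b2 u2 + rscale b3 u3.

Lemma dom_lin3 b1 b2 b3 : D (lin3 b1 b2 b3).
Proof. by do 2?apply: (domD T); apply: (domZ T) => //; exact: dom1 T. Qed.

Lemma star_lin3 b1 b2 b3 : star (lin3 b1 b2 b3) = lin3 b1 b2 b3.
Proof. by rewrite /lin3 !starD !star_rscale star1 U2.1 U3.1. Qed.

(** The square is stated through a real-linear functional, which turns the expansion
    in a noncommutative algebra into an identity of real numbers. *)
Lemma lin3_sqr f b1 b2 b3 : real_linear f ->
  f (lin3 b1 b2 b3 * lin3 b1 b2 b3) =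
    (b1 ^+ 2 + b2 ^+ 2 + b3 ^+ 2) * f 1 + 2 * b1 * b2 * f u2 + 2 * b1 * b3 * f u3
    + b2 * b3 * f (u2 * u3 + u3 * u2).
Proof.
move=> [fD fZ]; set rhs := (X in _ = X).
rewrite /lin3 !mulrDl !mulrDr !rscaleAl !rscaleAr !mul1r !mulr1.
by rewrite U2.2 U3.2 !(fD, fZ) /rhs fD; ring.
Qed.

Let s := u2 * u3 + u3 * u2.
Let v := u2 + u3.
Let w := u2 - u3.

Lemma vv : v * v = 1 + 1 + s.
Proof.
by rewrite /v mulrDl !mulrDr U2.2 U3.2 [u3 * u2 + 1]addrC addrACA.
Qed.

Lemma ww : w * w = 1 + 1 - s.
Proof. by rewrite /w mulrBl !mulrBr U2.2 U3.2 opprB addrACA -opprD. Qed.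

(** The element X = (1 + z) / 2, written as a square to make it positive. *)
Definition midpoint : A := rscale 4^-1 (v * v).

Lemma vv_midpoint : v * v = rscale 4 midpoint.
Proof. by rewrite rscaleA mulfV ?pnatr_eq0// rscale1. Qed.

Lemma one_midpoint : 1 - midpoint = rscale 4^-1 (w * w).
Proof.
apply/eqP; rewrite subr_eq -scalerDr ww vv addrACA addNr addr0.
rewrite (_ : 1 + 1 + (1 + 1) = rscale 4 1) ?rscaleA ?mulVf ?pnatr_eq0 ?rscale1//.
by rewrite (rmorph_nat (real_complex R)) scaler_nat -!mulr2n -mulrnA.
Qed.

Lemma ww_midpoint : w * w = rscale 4 (1 - midpoint).
Proof. by rewrite one_midpoint rscaleA mulfV ?pnatr_eq0// rscale1. Qed.

Definition ev : {poly R} -> A := horner_alg midpoint \o map_poly (real_complex R).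
HB.instance Definition _ := GRing.RMorphism.on ev.

Lemma evX : ev 'X = midpoint.
Proof. by rewrite /ev /= map_polyX horner_algX. Qed.

Lemma evZ r p : ev (r *: p) = rscale r (ev p).
Proof. by rewrite /ev /= map_polyZ linearZ /= mulr_algl. Qed.

Lemma ev_ind (P : A -> Prop) :
  P 1 -> P midpoint -> (forall a b, P a -> P b -> P (a + b)) ->
  (forall a b, P a -> P b -> P (a * b)) -> (forall r a, P a -> P (rscale r a)) ->
  forall p, P (ev p).
Proof.
move=> P1 PX PD PM PZ; elim/poly_ind => [|p c IH].
  by rewrite -(scale0r 1) evZ; apply: PZ; rewrite rmorph1.
rewrite rmorphD rmorphM/= evX -[c%:P]mulr1 mul_polyC evZ rmorph1.
by apply: PD; [exact: PM | exact: PZ].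
Qed.

Lemma dom_v : D v. Proof. exact: (domD T). Qed.
Lemma dom_w : D w. Proof. exact: domB. Qed.

Lemma dom_midpoint : D midpoint.
Proof. by apply: (domZ T); apply: (domM T); exact: dom_v. Qed.

Lemma dom_ev p : D (ev p).
Proof.
apply: ev_ind; [exact: dom1 T | exact: dom_midpoint | exact: domD T
  | exact: domM T | exact: domZ T].
Qed.

Lemma comm_s_l : GRing.comm u2 s.
Proof.
rewrite /GRing.comm /s mulrDr mulrDl !mulrA U2.2 mul1r -!mulrA U2.2 mulr1.
by rewrite addrC.
Qed.

Lemma comm_s_r : GRing.comm u3 s.
Proof.
rewrite /GRing.comm /s mulrDr mulrDl !mulrA U3.2 mul1r -!mulrA U3.2 mulr1.
by rewrite addrC.
Qed.

Lemma comm_ev u p : GRing.comm u s -> GRing.comm u (ev p).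
Proof.
move=> us; have cZ r a : GRing.comm u a -> GRing.comm u (rscale r a).
  by rewrite /GRing.comm rscaleAl rscaleAr => ->.
apply: ev_ind => [||a b|a b|] //; try exact: commr1.
- by apply: cZ; rewrite vv; do 2?apply: commrD => //; exact: commr1.
- exact: commrD.
- exact: commrM.
Qed.

Lemma comm_ev2 p : GRing.comm u2 (ev p). Proof. exact: comm_ev comm_s_l. Qed.
Lemma comm_ev3 p : GRing.comm u3 (ev p). Proof. exact: comm_ev comm_s_r. Qed.

Lemma comm_ev_v p : GRing.comm v (ev p).
Proof. by rewrite /GRing.comm mulrDl mulrDr comm_ev2 comm_ev3. Qed.

Lemma comm_ev_w p : GRing.comm w (ev p).
Proof. by rewrite /GRing.comm mulrBl mulrBr comm_ev2 comm_ev3. Qed.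

Lemma comm_lin3 b1 b2 b3 p : GRing.comm (lin3 b1 b2 b3) (ev p).
Proof.
by rewrite /GRing.comm !mulrDl !mulrDr !rscaleAl !rscaleAr mul1r mulr1
  comm_ev2 comm_ev3.
Qed.

Lemma star_v : star v = v. Proof. by rewrite starD U2.1 U3.1. Qed.
Lemma star_w : star w = w.
Proof. by rewrite starD -rscaleN1 star_rscale rscaleN1 U2.1 U3.1. Qed.

Lemma star_ev p : star (ev p) = ev p.
Proof.
have cE (q q' : {poly R}) : ev q * ev q' = ev q' * ev q by rewrite -!rmorphM mulrC.
elim/poly_ind: p => [|p c IH].
  by rewrite -(scale0r 1) evZ star_rscale rmorph1 star1.
rewrite rmorphD rmorphM/= starD starM IH cE evX /midpoint star_rscale starM star_v.
by rewrite -[c%:P]mulr1 mul_polyC evZ rmorph1 star_rscale star1.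
Qed.

(** X = (v / 2)^2 and 1 - X = (w / 2)^2 with v = u_2 + u_3 and w = u_2 - u_3, both of
    which commute with polynomials in X; the trace moves one factor to the other
    side. *)
Lemma tr_pos_bern k l a : D a -> 0 <= t (star a * a * ev (bern R k l)).
Proof.
have step q h c : D h -> star h = h -> ev q = rscale 4^-1 (h * h) ->
    GRing.comm h (ev c) -> (forall a, D a -> 0 <= t (star a * a * ev c)) ->
    forall a, D a -> 0 <= t (star a * a * ev (q * c)).
  move=> Dh hh qE hc pos x Dx.
  rewrite rmorphM/= qE rscaleAl rscaleAr (tr_lin T).2 mulr_ge0 ?invr_ge0//.
  rewrite -(mulrA h) hc !mulrA (trC T) //; last first.
    by do 3?apply: (domM T) => //; [exact: dom_star T _ _ | exact: dom_ev].
  have := pos (x * h) (domM T Dx Dh); rewrite starM hh.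
  by rewrite !mulrA.
elim: k a => [|k IHk]; last first.
  rewrite /bern exprS -mulrA; apply: (step _ v) => //.
  - exact: dom_v. 
  - exact: star_v.
  - by rewrite evX.
  - exact: comm_ev_v.
rewrite /bern expr0 mul1r; elim: l => [|l IHl].
  by move=> a _; rewrite expr0 rmorph1 mulr1; exact: (tr_pos T).
rewrite exprS; apply: (step _ w) => //.
- exact: dom_w.
- exact: star_w.
- by rewrite rmorphB rmorph1/= evX one_midpoint.
- exact: comm_ev_w.
Qed.

Definition poly_moment g (p : {poly R}) : R := t (g * ev p).

Lemma poly_moment_linear g : linear_for *%R (poly_moment g).
Proof.
move=> r p q; rewrite /poly_moment rmorphD /= evZ mulrDr rscaleAr.
by rewrite (tr_lin T).1 (tr_lin T).2.
Qed.

HB.instance Definition _ g :=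
  GRing.isLinear.Build R {poly R} R *%R (poly_moment g) (poly_moment_linear g).

Lemma sandwich h p : D h -> GRing.comm h (ev p) ->
  t (h * u1 * h * ev p) = t (u1 * (h * h) * ev p).
Proof.
move=> Dh hc; rewrite -2!mulrA (trC T) //; last first.
  by do ?apply: (domM T) => //; exact: dom_ev.
by rewrite -!mulrA hc.
Qed.

(** Positivity of t on x = h - e u_1 h, since (1 - e u_1)^2 = 2 (1 - e u_1). *)
Lemma trace_reflection_sandwich (e : bool) h k l :
  D h -> star h = h -> GRing.comm h (ev (bern R k l)) ->
  0 <= t (h * h * ev (bern R k l)) - bsign R e * t (u1 * (h * h) * ev (bern R k l)).
Proof.
move=> Dh hh hc; pose x := h - rscale (bsign R e) (u1 * h).
have Dx : D x by apply: domB => //; apply: (domZ T); exact: (domM T).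
have sx : star x = h - rscale (bsign R e) (h * u1).
  by rewrite starD -rscaleN1 star_rscale rscaleN1 star_rscale starM hh U1.1.
have ee : bsign R e * bsign R e = 1 by rewrite /bsign; case: (e); ring.
have xx : star x * x = h * h + h * h
    - (rscale (bsign R e) (h * u1 * h) + rscale (bsign R e) (h * u1 * h)).
  rewrite sx /x mulrBl !mulrBr !rscaleAl !rscaleAr rscaleA ee rscale1.
  by rewrite !mulrA -(mulrA h u1 u1) U1.2 mulr1 opprB addrACA -opprD.
have := tr_pos_bern k l Dx; rewrite xx mulrBl !mulrDl !rscaleAl.
set L := tr_lin T; rewrite !(real_linearB _ _ L) !L.1 !L.2 sandwich//; lra.
Qed.

(** Positivity of t on r g - e h. *)
Lemma trace_amgm g h (e : bool) r k l :
  D g -> reflection g -> D h -> star h = h -> GRing.comm h (ev (bern R k l)) ->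
  bsign R e * 2 * r * t (g * h * ev (bern R k l)) <=
    r ^+ 2 * t (ev (bern R k l)) + t (h * h * ev (bern R k l)).
Proof.
move=> Dg [sgg gg] Dh hh hc; pose x := rscale r g - rscale (bsign R e) h.
have Dx : D x by apply: domB; apply: (domZ T).
have sx : star x = x by rewrite starD -rscaleN1 !star_rscale rscaleN1 hh sgg.
have ee : bsign R e * bsign R e = 1 by rewrite /bsign; case: (e); ring.
have xx : star x * x = rscale (r ^+ 2) 1 - rscale (bsign R e * r) (h * g)
      - (rscale (r * bsign R e) (g * h) - h * h).
  by rewrite sx {2}/x mulrBr /x !mulrBl !rscaleAl !rscaleAr !rscaleA ee rscale1 gg expr2.
have := tr_pos_bern k l Dx; rewrite xx !mulrBl !rscaleAl mul1r.
set L := tr_lin T; rewrite !(real_linearB _ _ L) !L.2.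
rewrite [t (h * g * _)](_ : _ = t (g * h * ev (bern R k l))); first by lra.
rewrite -mulrA (trC T) //; last by apply: (domM T) => //; exact: dom_ev.
by rewrite -!mulrA hc.
Qed.

Lemma ev_cosine : rscale 2 (ev (2 * 'X - 1)) = s.
Proof.
have -> : 2 * 'X = (2 : R) *: 'X :> {poly R} by rewrite scaler_nat mulr_natl.
rewrite rmorphB rmorph1 /= evZ evX.
rewrite scalerBr rscaleA (_ : 2 * 2 = 4 :> R); last by ring.
have -> : rscale 2 1 = 1 + 1 :> A.
  by rewrite (rmorph_nat (real_complex R)) scaler_nat mulr2n.
by rewrite -vv_midpoint vv addrAC subrr add0r.
Qed.

Lemma tr_lin3_sqr g b1 b2 b3 p :
  t (g * (lin3 b1 b2 b3 * lin3 b1 b2 b3) * ev p) =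
    (b1 ^+ 2 + b2 ^+ 2 + b3 ^+ 2) * poly_moment g p
    + 2 * b1 * b2 * t (g * u2 * ev p) + 2 * b1 * b3 * t (g * u3 * ev p)
    + 2 * b2 * b3 * poly_moment g ((2 * 'X - 1) * p).
Proof.
have L := real_linear_mul g (ev p).
rewrite (lin3_sqr b1 b2 b3 L) -/s -ev_cosine L.2 mulr1 /poly_moment rmorphM /= (mulrA g); ring.
Qed.

(** The trace moves one factor c around, at the price of a sign. *)
Lemma anticomm_trace u c : D u -> D c -> u * c = - (c * u) ->
  forall p, GRing.comm c (ev p) -> t (u * (c * c) * ev p) = 0.
Proof.
move=> Du Dc uc p cp; have : t (u * (c * c) * ev p) = - t (u * (c * c) * ev p).
  rewrite {1}mulrA uc mulNr mulNr (real_linearN _ (tr_lin T)); congr (- _).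
  rewrite -!mulrA [LHS](trC T) //; last by do ?apply: (domM T) => //; exact: dom_ev.
  by rewrite -!mulrA cp.
by lra.
Qed.

Lemma vwE : v * w = u3 * u2 - u2 * u3.
Proof.
rewrite /v /w mulrBr !mulrDl U2.2 U3.2 opprD [1 + _]addrC.
by rewrite [- _ - 1]addrC addrA addrK.
Qed.

Lemma wvE : w * v = - (v * w).
Proof.
by rewrite vwE opprB /v /w mulrDr !mulrBl U2.2 U3.2 addrC addrA subrK.
Qed.

(** Up to a negative factor, X (1 - X) is the square of v w, which anticommutes with
    u_2 and u_3; hence t(u_2 b) = t(u_3 b) = 0 on the pieces b divisible by it. *)
Lemma midpoint_variance :
  midpoint * (1 - midpoint) = rscale (- 16^-1) ((v * w) * (v * w)).
Proof.
rewrite one_midpoint /midpoint rscaleAl rscaleAr rscaleA.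
rewrite -[in RHS]mulrA [w * (v * w)]mulrA wvE mulNr mulrN !mulrA.
by rewrite -[- (_ * w)]rscaleN1 rscaleA; congr (rscale _ _); field.
Qed.

Lemma anticomm2 : u2 * (v * w) = - (v * w * u2).
Proof. by rewrite vwE mulrBr mulrBl !mulrA U2.2 mul1r -!mulrA U2.2 mulr1 opprB. Qed.

Lemma anticomm3 : u3 * (v * w) = - (v * w * u3).
Proof. by rewrite vwE mulrBr mulrBl !mulrA U3.2 mul1r -!mulrA U3.2 mulr1 opprB. Qed.

Lemma moment_generic u k l : D u -> u * (v * w) = - (v * w * u) ->
  poly_moment u (bern R k.+1 l.+1) = 0.
Proof.
move=> Du uc; rewrite /poly_moment.
have -> : bern R k.+1 l.+1 = 'X * (1 - 'X) * bern R k l by rewrite /bern !exprS; ring.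
move: (bern R k l) => b.
rewrite !rmorphM rmorphB rmorph1 /= evX midpoint_variance rscaleAl rscaleAr (tr_lin T).2.
rewrite (mulrA u) anticomm_trace ?mulr0//.
  by apply: (domM T); [exact: dom_v | exact: dom_w].
by apply: commr_sym; apply: commrM; apply: commr_sym; [exact: comm_ev_v | exact: comm_ev_w].
Qed.

Lemma side_sqr (e : bool) k l :
  t ((u2 - rscale (bsign R e) u3) * (u2 - rscale (bsign R e) u3) * ev (bern R k l)) =
  4 * poly_moment 1 (bern R (k + ~~ e) (l + e)).
Proof.
rewrite /poly_moment mul1r; case: e => /=; rewrite ?addn0 addn1.
  have -> : bern R k l.+1 = (1 - 'X) * bern R k l by rewrite /bern exprS mulrCA.
  move: (bern R k l) => b; rewrite rscale1 -/w ww_midpoint rscaleAl (tr_lin T).2.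
  by rewrite rmorphM rmorphB rmorph1 /= evX.
have -> : bern R k.+1 l = 'X * bern R k l by rewrite /bern exprS mulrA.
move: (bern R k l) => b; rewrite rscaleN1 opprK -/v vv_midpoint rscaleAl.
by rewrite (tr_lin T).2 rmorphM /= evX.
Qed.

Lemma trace_moments :
  moment_system (poly_moment 1) (poly_moment u1) (poly_moment u2)
    (poly_moment u3) (poly_moment (u1 * u2)) (poly_moment (u1 * u3)).
Proof.
have Dh (e : bool) : D (u2 - rscale (bsign R e) u3) by apply: domB => //; exact: (domZ T).
have sh (e : bool) : star (u2 - rscale (bsign R e) u3) = u2 - rscale (bsign R e) u3.
  by rewrite starD -rscaleN1 !star_rscale !rscaleN1 U2.1 U3.1.
have ch (e : bool) p : GRing.comm (u2 - rscale (bsign R e) u3) (ev p).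
  by rewrite /GRing.comm mulrBl mulrBr rscaleAl rscaleAr comm_ev2 comm_ev3.
split=> /=.
- by rewrite /poly_moment rmorph1 mulr1 (tr1 T).
- move=> k l q; rewrite /poly_moment mul1r rmorphM rmorphXn /=.
  by have := @tr_pos_bern k l (ev q) (dom_ev q); rewrite star_ev.
- move=> k l e b1 b2 b3.
  have := trace_reflection_sandwich e (dom_lin3 b1 (- b2) (- b3)) (star_lin3 _ _ _)
    (@comm_lin3 _ _ _ (bern R k l)).
  rewrite -{1}[_ * lin3 _ _ _]mul1r !tr_lin3_sqr !mul1r.
  by rewrite /poly_moment; lra.
- by move=> k l; split; apply: moment_generic => //; [exact: anticomm2 | exact: anticomm3].
- move=> k l q e r; rewrite /poly_moment !mul1r [ev (q * _)]rmorphM /= mulrA.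
  rewrite [ev (q ^+ 2 * _)]rmorphM rmorphXn /= expr2.
  apply: trace_amgm => //; [exact: dom_ev | exact: star_ev|].
  by rewrite /GRing.comm -!rmorphM mulrC.
- move=> k l e s' r; have := @trace_amgm 1 _ s' r k l (dom1 T) _ (Dh e) (sh e) (ch e _).
  rewrite side_sqr mul1r mulrBl rscaleAl (real_linearB _ _ (tr_lin T)) (tr_lin T).2.
  by rewrite /poly_moment !mul1r; apply; split; [exact: star1 | rewrite mul1r].
- move=> k l e s' r; have := @trace_amgm u1 _ s' r k l D1 U1 (Dh e) (sh e) (ch e _).
  rewrite side_sqr mulrBr rscaleAr mulrBl rscaleAl (real_linearB _ _ (tr_lin T)) (tr_lin T).2.
  by rewrite /poly_moment !mul1r.
Qed.

Lemma trace_near_cone (eps : R) : 0 < eps -> exists x1 x2 x3 y12 y13 y23 : R,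
  [/\ sync_cone 1 x1 x2 x3 y12 y13 y23,
    [/\ `|x1 - t u1| <= eps, `|x2 - t u2| <= eps & `|x3 - t u3| <= eps],
    `|y12 - t (u1 * u2)| <= eps, `|y13 - t (u1 * u3)| <= eps
    & `|y23 - t (u2 * u3)| <= eps].
Proof.
move=> e0; have := near_cone1 trace_moments e0.
rewrite /near_cone /= !(mulr1, mul1r) /poly_moment rmorph1 !(mulr1, mul1r) (tr1 T).
suff -> : t (ev (2 * 'X - 1)) = t (u2 * u3) by [].
have := congr1 t ev_cosine; rewrite (tr_lin T).1 (tr_lin T).2 (trC T D3 D2); lra.
Qed.

End Trace.

(** * The closed set of correlations *)

Lemma cvg_ptws (I : Type) (V : topologicalType) (F : set_system (I -> V)) (f : I -> V) :
  Filter F -> (forall i, (fun g : I -> V => g i) @ F --> f i) -> {ptws, F --> f}.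
Proof.
move=> FF h; apply/cvg_sup => i; rewrite cvg_image; last first.
  by rewrite eqEsubset; split=> v // _; exists (cst v).
move=> W /h /= FW; exists [set g : I -> V | W (g i)] => //.
by rewrite eqEsubset; split => [_ [g Wg <-]//|y Wy]; exists (cst y).
Qed.

Section Correlation.
Variable R : realType.

Definition osign (i : 'I_2) : R := if i == ord0 then 1 else -1.
Definition tri (T : Type) (x1 x2 x3 : T) (i : 'I_3) : T :=
  if i == ord0 then x1 else if i == ord_max then x3 else x2.
Arguments tri {T}.

(** E_{x,i} = (1 + s_i u_x) / 2 with s_i = 1 for the outcome 0 and s_i = -1 for the
    outcome 1. *)
Definition moment_corr (a : 'I_3 -> R) (c : 'I_3 -> 'I_3 -> R) : tensor R 3 2 :=
  fun '(i, j, x, y) =>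
    (1 + osign i * a x + osign j * a y + osign i * osign j * c x y) / 4.

Definition sym3 (c12 c13 c23 : R) : 'I_3 -> 'I_3 -> R :=
  tri (tri 1 c12 c13) (tri c12 1 c23) (tri c13 c23 1).

Definition corr6 (a1 a2 a3 c12 c13 c23 : R) : tensor R 3 2 :=
  moment_corr (tri a1 a2 a3) (sym3 c12 c13 c23).

Definition sync_set : set (tensor R 3 2) :=
  [set p | exists a1 a2 a3 c12 c13 c23,
     sync_cone 1 a1 a2 a3 c12 c13 c23 /\ p = corr6 a1 a2 a3 c12 c13 c23].

(** The eight weights and the entries q, n_12, n_13, n_23 of the matrix in
    [sync_cone]. *)
Definition param : Type := {ptws (bool * bool * bool) + 'I_4 -> R}.
HB.instance Definition _ := Topological.on param.

Definition param_weight (f : param) s1 s2 s3 : R := f (inl (s1, s2, s3)).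
Definition param_gram (f : param) (i : nat) : R := f (inr (inord i)).

Definition params : set param :=
  [set f | [/\ forall s1 s2 s3, 0 <= param_weight f s1 s2 s3,
    psd3 (param_gram f 0) (param_gram f 1) (param_gram f 2) (param_gram f 3)
   & atom_sum (param_weight f) (fun _ _ _ => 1) + param_gram f 0 = 1]].

Definition param_corr (f : param) : tensor R 3 2 :=
  corr6 (atom_sum (param_weight f) (fun s1 _ _ => bsign R s1))
        (atom_sum (param_weight f) (fun _ s2 _ => bsign R s2))
        (atom_sum (param_weight f) (fun _ _ s3 => bsign R s3))
        (atom_sum (param_weight f) (fun s1 s2 _ => bsign R s1 * bsign R s2) + param_gram f 1)
        (atom_sum (param_weight f) (fun s1 _ s3 => bsign R s1 * bsign R s3) + param_gram f 2)
        (atom_sum (param_weight f) (fun _ s2 s3 => bsign R s2 * bsign R s3) + param_gram f 3).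

Lemma sync_set_image : sync_set = param_corr @` params.
Proof.
apply/seteqP; split=> p.
- move=> [? [? [? [? [? [? [C ->]]]]]]].
  case: C => [w [q [x [y [z [w0 P [m [-> -> ->] -> -> ->]]]]]]].
  pose f : param := fun i => match i with
    | inl (s1, s2, s3) => w s1 s2 s3
    | inr i => nth 0 [:: q; x; y; z] i end.
  have fw : param_weight f = w by [].
  have fq i : (i < 4)%N -> param_gram f i = nth 0 [:: q; x; y; z] i.
    by move=> i4; rewrite /param_gram /f inordK.
  by exists f; rewrite /params /param_corr /= fw !fq.
- move=> [f [w0 P m] <-]; do 6!eexists; split; last reflexivity.
  exists (param_weight f), (param_gram f 0), (param_gram f 1), (param_gram f 2),
    (param_gram f 3).
  by split=> //; split=> //.
Qed.

Lemma cont_param_eval (i : (bool * bool * bool) + 'I_4) : continuous (fun f : param => f i : R).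
Proof. exact: (@proj_continuous _ (fun=> R)). Qed.

Lemma cont_param_gram i : continuous (fun f : param => param_gram f i).
Proof. exact: cont_param_eval. Qed.

Lemma cont_scale (T : topologicalType) (g : T -> R) (c : R) :
  continuous g -> continuous (fun f => g f * c).
Proof. by move=> gc f; apply: cvgMl; exact: gc. Qed.

Lemma cont_scalel (T : topologicalType) (g : T -> R) (c : R) :
  continuous g -> continuous (fun f => c * g f).
Proof. by move=> gc f; apply: cvgMr; exact: gc. Qed.

Lemma cont_add (T : topologicalType) (g h : T -> R) :
  continuous g -> continuous h -> continuous (fun f => g f + h f).
Proof. by move=> gc hc f; apply: cvgD; [exact: gc | exact: hc]. Qed.

Lemma cont_atom_sum g : continuous (fun f : param => atom_sum (param_weight f) g).
Proof.
have -> : (fun f : param => atom_sum (param_weight f) g) = fun f =>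
   (let h s1 s2 s3 := param_weight f s1 s2 s3 * g s1 s2 s3 in
    (h true true true + h true true false + (h true false true + h true false false)) +
    (h false true true + h false true false + (h false false true + h false false false))).
  by apply/funext => f; rewrite /atom_sum !big_bool.
by do !apply: cont_add; apply: cont_scale; exact: cont_param_eval.
Qed.

Lemma cont_tri (a b c : param -> R) z :
  continuous a -> continuous b -> continuous c ->
  continuous (fun f => tri (a f) (b f) (c f) z).
Proof. by move=> ? ? ?; rewrite /tri; case: (z == ord0); last case: (z == ord_max). Qed.

Lemma cont_cst (T : topologicalType) (c : R) : continuous (fun f : T => c).
Proof. exact: cst_continuous. Qed.

Lemma cont_sym3 (a b c : param -> R) x y :
  continuous a -> continuous b -> continuous c ->
  continuous (fun f => sym3 (a f) (b f) (c f) x y).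
Proof.
move=> ca cb cc; have c1 := @cont_cst param 1.
rewrite /sym3 [in X in continuous X]/tri.
by case: (x == ord0); last case: (x == ord_max); exact: cont_tri.
Qed.

Lemma cont_corr6 (a1 a2 a3 c12 c13 c23 : param -> R) i :
  continuous a1 -> continuous a2 -> continuous a3 ->
  continuous c12 -> continuous c13 -> continuous c23 ->
  continuous (fun f => corr6 (a1 f) (a2 f) (a3 f) (c12 f) (c13 f) (c23 f) i).
Proof.
move=> h1 h2 h3 h12 h13 h23; case: i => [[[i j] x] y].
rewrite /corr6 /moment_corr; apply: cont_scale.
apply: cont_add; last by apply: cont_scalel; exact: cont_sym3.
apply: cont_add; last by apply: cont_scalel; exact: cont_tri.
by apply: cont_add; [exact: cont_cst | apply: cont_scalel; exact: cont_tri].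
Qed.

Lemma param_corr_continuous : continuous (param_corr : param -> tensor R 3 2).
Proof.
move=> f; refine (@cvg_ptws _ R (param_corr @ nbhs f) (param_corr f) _ _) => i.
have C := @cont_corr6
   (fun f => atom_sum (param_weight f) (fun s1 _ _ => bsign R s1))
   (fun f => atom_sum (param_weight f) (fun _ s2 _ => bsign R s2))
   (fun f => atom_sum (param_weight f) (fun _ _ s3 => bsign R s3))
   (fun f => atom_sum (param_weight f) (fun s1 s2 _ => bsign R s1 * bsign R s2) + param_gram f 1)
   (fun f => atom_sum (param_weight f) (fun s1 _ s3 => bsign R s1 * bsign R s3) + param_gram f 2)
   (fun f => atom_sum (param_weight f) (fun _ s2 s3 => bsign R s2 * bsign R s3) + param_gram f 3)
   i (@cont_atom_sum _) (@cont_atom_sum _) (@cont_atom_sum _)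
   (cont_add (@cont_atom_sum _) (@cont_param_gram 1))
   (cont_add (@cont_atom_sum _) (@cont_param_gram 2))
   (cont_add (@cont_atom_sum _) (@cont_param_gram 3)).
exact: (C f).
Qed.

Lemma closed_ge0 (T : topologicalType) (g : T -> R) :
  continuous g -> closed [set f | 0 <= g f].
Proof. by move=> /continuous_closedP/(_ _ (@closed_ge R 0)). Qed.

Lemma closed_forall (T : topologicalType) (I : Type) (P : I -> set T) :
  (forall i, closed (P i)) -> closed [set f | forall i, P i f].
Proof.
move=> cP; have := @closed_bigI T I setT P (fun i _ => cP i).
by congr closed; apply/seteqP; split=> f /= h i; [exact: h | move=> _; exact: h].
Qed.

Lemma params_closed : closed params.
Proof.
have -> : params = [set f | forall s : bool * bool * bool, 0 <= param_weight f s.1.1 s.1.2 s.2]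
  `&` [set f | forall b : R * R * R, 0 <= param_gram f 0 *
         (b.1.1 ^+ 2 + b.1.2 ^+ 2 + b.2 ^+ 2)
       + 2 * (b.1.1 * b.1.2 * param_gram f 1 + b.1.1 * b.2 * param_gram f 2
              + b.1.2 * b.2 * param_gram f 3)]
  `&` [set f | 0 <= atom_sum (param_weight f) (fun _ _ _ => 1) + param_gram f 0 - 1]
  `&` [set f | 0 <= -1 * (atom_sum (param_weight f) (fun _ _ _ => 1) + param_gram f 0) + 1].
  apply/seteqP; split=> f.
    move=> [w0 P m]; split; [split; [split|]|] => //=.
    - by rewrite m subrr.
    - by rewrite m mulN1r addNr.
  move=> [[[w0 P] m1] m2]; split.
  - by move=> s1 s2 s3; exact: (w0 (s1, s2, s3)).
  - by move=> b1 b2 b3; exact: (P (b1, b2, b3)).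
  - by move: m1 m2 => /=; lra.
have cm : continuous (fun f : param => atom_sum (param_weight f) (fun _ _ _ => 1) + param_gram f 0).
  by apply: cont_add; [exact: cont_atom_sum | exact: cont_param_gram].
repeat apply: closedI.
- by apply: closed_forall => -[[s1 s2] s3]; apply: closed_ge0; exact: cont_param_eval.
- apply: closed_forall => -[[b1 b2] b3]; apply: closed_ge0.
  apply: cont_add; first by apply: cont_scale; exact: cont_param_gram.
  apply: cont_scalel; do 2?apply: cont_add; apply: cont_scalel; exact: cont_param_gram.
- by apply: closed_ge0; apply: cont_add => //; exact: cont_cst.
- by apply: closed_ge0; apply: cont_add; [exact: cont_scalel | exact: cont_cst].
Qed.

(** The test vectors e_i and e_i + e_j, e_i - e_j suffice. *)
Lemma psd3_bound (q x y z : R) : psd3 q x y z -> [/\ 0 <= q, `|x| <= q, `|y| <= q & `|z| <= q].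
Proof.
move=> P.
have := (P 1 0 0, P 1 1 0, P 1 (-1) 0, P 1 0 1, P 1 0 (-1), P 0 1 1, P 0 1 (-1)).
move=> [[[[[[]]]]]] *.
by split; rewrite ?ler_norml; [|apply/andP; split..]; lra.
Qed.

Lemma params_compact : compact params.
Proof.
pose box : set param := [set f | forall i, `[-1, 1]%classic (f i)].
have cbox : compact box.
  by apply: (@tychonoff _ (fun=> R) (fun=> `[-1, 1]%classic)) => i; exact: segment_compact.
apply: subclosed_compact params_closed cbox _ => f [w0 /psd3_bound[q0 x y z] m].
have : forall s1 s2 s3, param_weight f s1 s2 s3 <= 1 - param_gram f 0.
  move=> s1 s2 s3; move: m; rewrite /atom_sum !big_bool /= => m.
  have := (w0 true true true, w0 true true false, w0 true false true, w0 true false false,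
   w0 false true true, w0 false true false, w0 false false true, w0 false false false).
  by move=> [[[[[[[]]]]]]] *; case: s1 s2 s3 => [] [] []; lra.
have s0 : 0 <= atom_sum (param_weight f) (fun _ _ _ => 1).
  by rewrite /atom_sum; do 3!apply: sumr_ge0 => ? _; rewrite mulr1.
move=> w1 [[[s1 s2] s3]|i] /=; rewrite in_itv /=.
  have := w1 s1 s2 s3; have := w0 s1 s2 s3; rewrite /param_weight => *.
  by apply/andP; split; lra.
rewrite -ler_norml; have -> : f (inr i) = param_gram f i by rewrite /param_gram inord_val.
have q1 : param_gram f 0 <= 1 by lra.
by case: i => [[|[|[|[|//]]]]] ilt /=; rewrite ?(ger0_norm q0)//; exact: le_trans q1.
Qed.

Lemma tensor_hausdorff : hausdorff_space (tensor R 3 2).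
Proof. by apply: (@hausdorff_product _ (fun=> R)) => _; exact: Rhausdorff. Qed.

Lemma sync_set_closed : closed sync_set.
Proof.
rewrite sync_set_image; apply: compact_closed; first exact: tensor_hausdorff.
apply: continuous_compact params_compact; apply: continuous_subspaceT.
exact: param_corr_continuous.
Qed.

Lemma sync_set_approx (p : tensor R 3 2) :
  (forall eps : R, 0 < eps ->
     exists2 p', sync_set p' & forall i, `|p' i - p i| <= eps) -> sync_set p.
Proof.
move=> h; have /choice[f Hf] : forall n : nat,
    exists p', sync_set p' /\ forall i, `|p' i - p i| <= n.+1%:R^-1.
  by move=> n; have [|p' ? ?] := h n.+1%:R^-1; [rewrite invr_gt0 | exists p'].
refine (@closed_cvg _ (tensor R 3 2) \oo _ f sync_set sync_set_closed _ p _).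
  by apply: nearW => n; case: (Hf n).
refine (@cvg_ptws _ R (f @ \oo) p _ _) => i.
suff : f n i @[n --> \oo] --> p i by [].
apply/cvgrPdist_le => e e0; near=> n.
rewrite distrC (le_trans ((Hf n).2 i))// ltW//.
by near: n; exact: (near_infty_natSinv_lt (PosNum e0)).
Unshelve. all: by end_near. Qed.

End Correlation.

(** * From synchronous correlations to traces *)

Section State.
Variables (R : realType) (A : cstarAlgType R) (phi : {scalar A}).
Hypothesis S : is_state phi.
Implicit Types (a b x h : A) (r : R).

Definition re_state a : R := complex.Re (phi a).
Let t := re_state.

Lemma re_state_linear : real_linear t.
Proof.
split=> [a b|r a]; first by rewrite /t /re_state linearD raddfD.
by rewrite /t /re_state linearZ /=; case: (phi a) => x y /=; rewrite mul0r subr0.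
Qed.

Lemma re_state_pos a : 0 <= t (star a * a).
Proof. by have := S.2 a; rewrite /t /re_state lecE => /andP[]. Qed.

Lemma re_state1 : t 1 = 1.
Proof. by rewrite /t /re_state S.1. Qed.

(** Positivity at 1 + i a says that t(a) and t(star a) agree. *)
Lemma re_state_star a : t (star a) = t a.
Proof.
have E : star (1 + 'i%C *: a) * (1 + 'i%C *: a) =
    1 + 'i%C *: a + conjc 'i%C *: star a + (conjc 'i%C * 'i%C) *: (star a * a).
  rewrite starD starZ star1 mulrDl !mulrDr !mul1r !mulr1 -scalerAl -scalerAr scalerA.
  by rewrite !addrA.
have := S.2 (1 + 'i%C *: a); have := S.2 a; rewrite E !linearD !linearZ /= S.1.
rewrite !lecE /= => /andP[/eqP + _] /andP[/eqP + _]; rewrite /t /re_state.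
case: (phi (star a * a)) => u u'; case: (phi a) => v v'.
by case: (phi (star a)) => z z' /=; lra.
Qed.

(** Otherwise positivity at r b^{star} + h would fail for small r of a suitable sign. *)
Lemma null_right h : t (star h * h) = 0 -> forall b, t (b * h) = 0.
Proof.
move=> h0 b; set c := t (b * star b).
have q r : 0 <= r ^+ 2 * c + 2 * r * t (b * h).
  have := re_state_pos (rscale r (star b) + h).
  rewrite starD star_rscale starK mulrDl !mulrDr !rscaleAl !rscaleAr rscaleA.
  rewrite !re_state_linear.1 !re_state_linear.2 h0 -/c.
  by rewrite -[t (star h * star b)]re_state_star starM !starK; lra.
have c0 : 0 <= c by have := re_state_pos (star b); rewrite starK.
have [cz|cz] := eqVneq c 0.
  by have := q 1; have := q (-1); rewrite cz; lra.
have cp : 0 < c by rewrite lt_neqAle eq_sym cz.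
have := q (- t (b * h) / c).
have -> : (- t (b * h) / c) ^+ 2 * c + 2 * (- t (b * h) / c) * t (b * h)
   = - (t (b * h) ^+ 2 / c) by field.
rewrite oppr_ge0 pmulr_lle0 ?invr_gt0// => h'.
by apply/eqP; rewrite -sqrf_eq0 eq_le h' sqr_ge0.
Qed.

Lemma null_left h : star h = h -> t (star h * h) = 0 -> forall b, t (h * b) = 0.
Proof.
move=> hh h0 b; rewrite -re_state_star starM hh; exact: null_right.
Qed.

End State.

Lemma rscale_half (R : realType) (A : cstarAlgType R) (a : A) : rscale 2^-1 (a + a) = a.
Proof.
have -> : a + a = rscale 2 a.
  by rewrite (rmorph_nat (real_complex R)) scaler_nat mulr2n.
by rewrite rscaleA mulVf ?pnatr_eq0// rscale1.
Qed.

Section PVM.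
Variables (R : realType) (A : cstarAlgType R) (P : 'I_2 -> A).
Hypothesis HP : is_pvm P.

Definition observable : A := P ord0 - P ord_max.

Lemma pvm_sum : P ord0 + P ord_max = 1.
Proof. by rewrite -HP.2 big_ord_recl big_ord1; congr (_ + P _); apply: val_inj. Qed.

Lemma pvmE i : P i = rscale 2^-1 (1 + rscale (osign R i) observable).
Proof.
rewrite -pvm_sum /observable.
have [->|->] : i = ord0 \/ i = ord_max.
  by case: i => [[|[|//]]] ?; [left|right]; apply: val_inj.
- by rewrite /osign eqxx rscale1 addrACA subrr addr0 rscale_half.
- by rewrite /osign /= rscaleN1 opprB [P ord_max - _]addrC addrACA subrr add0r rscale_half.
Qed.

Lemma observable_reflection : reflection observable.
Proof.
have [[p0 p1] _] := (HP.1 ord0, HP.1 ord_max); have [q0 q1] := HP.1 ord_max.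
split; first by rewrite /observable starD -rscaleN1 !star_rscale !rscaleN1 -p0 -q0.
have E : P ord_max = 1 - P ord0 by rewrite -pvm_sum addrAC subrr add0r.
rewrite /observable E mulrBl !mulrBr !mulrBl !mul1r !mulr1 -expr2 -p1.
by rewrite !(opprB, subrr, subr0, addr0, sub0r, opprK) addrC subrK.
Qed.

End PVM.

Section Synchronous.
Variables (R : realType) (A : cstarAlgType R) (E F : 'I_3 -> 'I_2 -> A).
Variables (phi : {scalar A}) (p : tensor R 3 2).
Hypotheses (HE : forall x, is_pvm (E x)) (HF : forall y, is_pvm (F y)).
Hypothesis EF : forall x y i j, E x i * F y j = F y j * E x i.
Hypothesis S : is_state phi.
Hypothesis pE : forall x y i j, (p (i, j, x, y))%:C%C = phi (E x i * F y j).
Hypothesis syn : synchronous p.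

Let t := re_state phi.
Let tl : real_linear t := re_state_linear phi.
Let t1 : t 1 = 1 := re_state1 S.
Let u x := observable (E x).
Let w y := observable (F y).

(** The u_x lie in the commutant of F, and the state is a trace there as soon as one
    of the two factors is a polynomial in the u_x. *)
Definition commutant (a : A) := forall y j, a * F y j = F y j * a.
Definition centralizer (a : A) :=
  commutant a /\ forall b, commutant b -> t (a * b) = t (b * a).

Lemma commutantM a b : commutant a -> commutant b -> commutant (a * b).
Proof. by move=> ca cb y j; rewrite -mulrA cb !mulrA ca. Qed.

Lemma commutantD a b : commutant a -> commutant b -> commutant (a + b).
Proof. by move=> ca cb y j; rewrite mulrDl mulrDr ca cb. Qed.

Lemma commutantZ r a : commutant a -> commutant (rscale r a).
Proof. by move=> ca y j; rewrite rscaleAl rscaleAr ca. Qed.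

Lemma commutant1 : commutant 1.
Proof. by move=> y j; rewrite mul1r mulr1. Qed.

Lemma commutant_star a : commutant a -> commutant (star a).
Proof.
move=> ca y j; have [sF _] := (HF y).1 j.
by rewrite sF -!starM ca.
Qed.

Lemma commutant_u x : commutant (u x).
Proof. by move=> y j; rewrite /u /observable mulrBl mulrBr !EF. Qed.

Lemma commutant_w a y : commutant a -> a * w y = w y * a.
Proof. by move=> ca; rewrite /w /observable mulrBl mulrBr !ca. Qed.

Lemma p_trace x y i j : p (i, j, x, y) = t (E x i * F y j).
Proof. by rewrite /t /re_state -pE. Qed.

Lemma tr_uw x : t (u x * w x) = 1.
Proof.
have P i j : i != j -> t (E x i * F x j) = 0 by move=> ij; rewrite -p_trace syn.
have : t ((E x ord0 + E x ord_max) * (F x ord0 + F x ord_max)) = 1.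
  by rewrite (pvm_sum (HE x)) (pvm_sum (HF x)) mulr1 t1.
rewrite /u /w /observable.
rewrite mulrBl !mulrBr mulrDl !mulrDr !(real_linearB _ _ tl) !tl.1.
by rewrite !(P ord0 ord_max) // !(P ord_max ord0) //; lra.
Qed.

Lemma star_uw x : star (u x - w x) = u x - w x.
Proof.
have [[su _] [sw _]] := (observable_reflection (HE x), observable_reflection (HF x)).
by rewrite starD -rscaleN1 !star_rscale !rscaleN1 su sw.
Qed.

(** Hence u_x and w_x can be exchanged at either end of a product: Alice's
    observable acts on the state as Bob's does. *)
Lemma uw_null x : t (star (u x - w x) * (u x - w x)) = 0.
Proof.
have uu : u x * u x = 1 := (observable_reflection (HE x)).2.
have ww : w x * w x = 1 := (observable_reflection (HF x)).2.
rewrite star_uw mulrBl (mulrBr (u x)) (mulrBr (w x)) uu ww -commutant_w; last exact: commutant_u.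
by rewrite !(real_linearB _ _ tl) tr_uw t1; lra.
Qed.

Lemma uw_right x b : t (b * u x) = t (b * w x).
Proof.
have : t (b * (u x - w x)) = 0 := null_right S (uw_null x) b.
by rewrite mulrBr (real_linearB _ _ tl) => /eqP; rewrite subr_eq0 => /eqP.
Qed.

Lemma uw_left x b : t (u x * b) = t (w x * b).
Proof.
have : t ((u x - w x) * b) = 0 := null_left S (star_uw x) (uw_null x) b.
by rewrite mulrBl (real_linearB _ _ tl) => /eqP; rewrite subr_eq0 => /eqP.
Qed.

(** t(u b) = t(w b) = t(b w) = t(b u). *)
Lemma centralizer_u x : centralizer (u x).
Proof.
split=> [|b cb]; first exact: commutant_u.
by rewrite uw_right uw_left commutant_w.
Qed.

Lemma centralizer_tracial : tracial t centralizer.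
Proof.
split=> //.
- exact: re_state_pos S.
- by split=> [|b _]; [exact: commutant1 | rewrite mul1r mulr1].
- move=> a b [ca ta] [cb tb]; split=> [|c cc]; first exact: commutantD.
  by rewrite mulrDl mulrDr !tl.1 ta// tb.
- move=> a b [ca ta] [cb tb]; split=> [|c cc]; first exact: commutantM.
  by rewrite -mulrA ta ?tb -?mulrA ?tb ?mulrA//; exact: commutantM.
- move=> r a [ca ta]; split=> [|c cc]; first exact: commutantZ.
  by rewrite rscaleAl rscaleAr !tl.2 ta.
- move=> a [ca ta]; split=> [|c cc]; first exact: commutant_star.
  have sc := commutant_star cc.
  have ts x : t (star x) = t x := re_state_star S x.
  by rewrite -[LHS]ts -[RHS]ts !starM starK ta.
- by move=> a b [_ ta] [cb _]; exact: ta.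
Qed.

Lemma p_moment_corr : p = moment_corr (fun x => t (u x)) (fun x y => t (u x * u y)).
Proof.
apply/funext => -[[[i j] x] y]; rewrite p_trace (pvmE (HE x) i) (pvmE (HF y) j) /moment_corr.
set rhs := (X in _ = X); rewrite -/(u x) -/(w y) rscaleAl rscaleAr rscaleA tl.2.
rewrite mulrDl mul1r mulrDr mulr1 rscaleAl rscaleAr !tl.1 !tl.2.
have -> : t (w y) = t (u y) by rewrite -[w y]mul1r -uw_right mul1r.
by rewrite -uw_right t1 /rhs; field.
Qed.

Lemma synchronous_in_sync_set : sync_set p.
Proof.
pose i1 : 'I_3 := ord0; pose i2 : 'I_3 := Ordinal (isT : (1 < 3)%N); pose i3 : 'I_3 := ord_max.
have T := centralizer_tracial.
have U x := observable_reflection (HE x).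
apply: sync_set_approx => eps e0.
have [x1 [x2 [x3 [y12 [y13 [y23 [C [h1 h2 h3] h12 h13 h23]]]]]]] :=
  trace_near_cone T (centralizer_u i1) (centralizer_u i2) (centralizer_u i3)
   (U i1) (U i2) (U i3) e0.
exists (corr6 x1 x2 x3 y12 y13 y23); first by exists x1, x2, x3, y12, y13, y23.
have I x : [\/ x = i1, x = i2 | x = i3].
  by case: x => [[|[|[|//]]]] ?; [apply: Or31|apply: Or32|apply: Or33]; apply: val_inj.
have ha x : `|tri x1 x2 x3 x - t (u x)| <= eps by case: (I x) => ->.
have hc x y : `|sym3 y12 y13 y23 x y - t (u x * u y)| <= eps.
  have tC a b : t (u a * u b) = t (u b * u a).
    by apply: (trC T); exact: centralizer_u.
  have tuu a : t (u a * u a) = 1 by rewrite (U a).2 t1.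
  case: (I x) (I y) => -> [] ->; rewrite /sym3 /tri /= ?tuu ?subrr ?normr0 ?(ltW e0)//.
  - by rewrite tC.
  - by rewrite tC.
  - by rewrite tC.
rewrite p_moment_corr => -[[[i j] x] y]; rewrite /corr6 /moment_corr.
have sN k (z : R) : `|osign R k * z| = `|z|.
  by rewrite /osign; case: (k == ord0); rewrite ?mul1r ?mulN1r ?normrN.
have n1 : `|osign R i * (tri x1 x2 x3 x - t (u x))| <= eps by rewrite sN.
have n2 : `|osign R j * (tri x1 x2 x3 y - t (u y))| <= eps by rewrite sN.
have n3 : `|osign R i * (osign R j * (sym3 y12 y13 y23 x y - t (u x * u y)))| <= eps.
  by rewrite !sN.
by move: n1 n2 n3; rewrite !ler_norml => /andP[? ?] /andP[? ?] /andP[? ?]; apply/andP; split; lra.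
Qed.

End Synchronous.

Lemma C_qc_s_sub_sync_set (R : realType) : C_qc_s R 3 2 `<=` @sync_set R.
Proof.
move=> p [[A [E [F [phi [HE HF EF S pE]]]]] syn].
exact: synchronous_in_sync_set HE HF EF S pE syn.
Qed.

(** * Matrices as a C-star algebra *)

Section Euclid.
Variable R : realType.
Implicit Types (c : R[i]) (r : R).

(** The modulus in the form in which it enters the scaling axiom of the norm. *)
Definition cmod c : R := complex.Re `|c|.

Definition cdot (c d : R[i]) : R :=
  complex.Re c * complex.Re d + complex.Im c * complex.Im d.

Lemma cmod_ge0 c : 0 <= cmod c.
Proof. by case: c => x y; rewrite /cmod normc_def /= sqrtr_ge0. Qed.

Lemma cmod_sqr c : cmod c ^+ 2 = cdot c c.
Proof.
case: c => x y; rewrite /cmod normc_def /= sqr_sqrtr ?addr_ge0 ?sqr_ge0//.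
Qed.

Lemma cmod_gt0 c : c != 0 -> 0 < cmod c.
Proof.
move=> c0; rewrite lt_neqAle cmod_ge0 andbT eq_sym.
by rewrite /cmod; move: c0; rewrite -normr_eq0; case: c => x y;
  rewrite normc_def /= eq_complex /= eqxx andbT.
Qed.

Lemma cmodV c : c != 0 -> cmod c^-1 * cmod c = 1.
Proof.
move=> c0; have : `|c^-1| * `|c| = 1 by rewrite -normrM mulVf// normr1.
move=> /(congr1 (@complex.Re R)); rewrite /cmod.
by case: c c0 => x y _; case: (_^-1) => x' y'; rewrite !normc_def /= mulr0 subr0.
Qed.

Lemma Re_le_cmod c : `|complex.Re c| <= cmod c.
Proof.
rewrite -ler_sqr ?nnegrE ?cmod_ge0// cmod_sqr real_normK ?num_real// /cdot -expr2.
by rewrite lerDl -expr2 sqr_ge0.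
Qed.

Lemma Im_le_cmod c : `|complex.Im c| <= cmod c.
Proof.
rewrite -ler_sqr ?nnegrE ?cmod_ge0// cmod_sqr real_normK ?num_real// /cdot -!expr2.
by rewrite lerDr sqr_ge0.
Qed.

Lemma cmod_le c : cmod c <= `|complex.Re c| + `|complex.Im c|.
Proof.
rewrite -ler_sqr ?nnegrE ?cmod_ge0 ?addr_ge0// cmod_sqr /cdot sqrrD.
rewrite !real_normK ?num_real// -!expr2 lerD2r lerDl mulrn_wge0// mulr_ge0//.
Qed.

Variable n : nat.
Implicit Types (v w : 'cV[R[i]]_n) (a : 'M[R[i]]_n).

Definition rdot v w : R := \sum_i cdot (v i 0) (w i 0).
Definition nrm v : R := Num.sqrt (rdot v v).

Lemma rdotC v w : rdot v w = rdot w v.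
Proof. by apply: eq_bigr => i _; rewrite /cdot; ring. Qed.

Lemma rdotDl v v' w : rdot (v + v') w = rdot v w + rdot v' w.
Proof.
rewrite -big_split; apply: eq_bigr => i _; rewrite mxE /cdot.
by rewrite !raddfD /=; ring.
Qed.

Lemma rdotZl r v w : rdot (r%:C%C *: v) w = r * rdot v w.
Proof.
rewrite mulr_sumr; apply: eq_bigr => i _; rewrite mxE /cdot.
by case: (v i 0) => x y /=; ring.
Qed.

Lemma rdotDr v w w' : rdot v (w + w') = rdot v w + rdot v w'.
Proof. by rewrite rdotC rdotDl !(rdotC _ v). Qed.

Lemma rdotZr r v w : rdot v (r%:C%C *: w) = r * rdot v w.
Proof. by rewrite rdotC rdotZl rdotC. Qed.

Lemma cdot_ge0 c : 0 <= cdot c c.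
Proof. by rewrite -cmod_sqr sqr_ge0. Qed.

Lemma rdot_ge0 v : 0 <= rdot v v.
Proof. by apply: sumr_ge0 => i _; exact: cdot_ge0. Qed.

Lemma nrm_ge0 v : 0 <= nrm v. Proof. exact: sqrtr_ge0. Qed.

Lemma nrm_sqr v : nrm v ^+ 2 = rdot v v.
Proof. by rewrite sqr_sqrtr// rdot_ge0. Qed.

Lemma entry_le v i : cmod (v i 0) <= nrm v.
Proof.
rewrite -ler_sqr ?nnegrE ?cmod_ge0 ?nrm_ge0// cmod_sqr nrm_sqr /rdot (bigD1 i)//=.
by rewrite lerDl sumr_ge0// => j _; exact: cdot_ge0.
Qed.

Lemma nrm_eq0 v : nrm v = 0 -> v = 0.
Proof.
move=> v0; apply/matrixP => i j; rewrite mxE (ord1 j); apply/eqP.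
have := entry_le v i; rewrite v0; apply: contraTT => /cmod_gt0.
by rewrite -ltNge.
Qed.

Lemma nrmZ c v : nrm (c *: v) = cmod c * nrm v.
Proof.
apply/eqP; rewrite -(@eqrXn2 _ 2) ?mulr_ge0 ?cmod_ge0 ?nrm_ge0// exprMn !nrm_sqr cmod_sqr.
rewrite mulr_sumr; apply/eqP/eq_bigr => i _; rewrite mxE /cdot.
by case: c => x y; case: (v i 0) => x' y' /=; ring.
Qed.

(** Cauchy-Schwarz, from the positivity of |w| v - |v| w. *)
Lemma rdot_le v w : rdot v w <= nrm v * nrm w.
Proof.
have [v0|v0] := eqVneq (nrm v) 0.
  rewrite v0 mul0r (nrm_eq0 v0) -(scale0r 0) (rdotZl 0) mul0r//.
have [w0|w0] := eqVneq (nrm w) 0.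
  rewrite w0 mulr0 (nrm_eq0 w0) -(scale0r 0) (rdotZr 0) mul0r//.
have vp : 0 < nrm v by rewrite lt_neqAle eq_sym v0 nrm_ge0.
have wp : 0 < nrm w by rewrite lt_neqAle eq_sym w0 nrm_ge0.
have := rdot_ge0 ((nrm w)%:C%C *: v + (- nrm v)%:C%C *: w).
rewrite rdotDl !rdotDr !rdotZl !rdotZr -!nrm_sqr (rdotC w v).
set x := rdot v w => h; rewrite -subr_ge0.
have : 0 <= 2 * (nrm v * nrm w) * (nrm v * nrm w - x) by move: h; lra.
by rewrite pmulr_rge0// !mulr_gt0.
Qed.

Lemma nrmD v w : nrm (v + w) <= nrm v + nrm w.
Proof.
rewrite -ler_sqr ?nnegrE ?addr_ge0 ?nrm_ge0// nrm_sqr rdotDl !rdotDr -!nrm_sqr (rdotC w v).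
by have := rdot_le v w; lra.
Qed.

Definition ctmx a : 'M[R[i]]_n := (map_mx conjc a)^T.

Lemma ctmxK a : ctmx (ctmx a) = a.
Proof. by apply/matrixP => i j; rewrite !mxE conjcK. Qed.

Lemma rdot_ctmx a v w : rdot (a *m v) w = rdot v (ctmx a *m w).
Proof.
rewrite /rdot.
transitivity (\sum_i \sum_j cdot (a i j * v j 0) (w i 0)).
  apply: eq_bigr => i _; rewrite mxE /cdot !raddf_sum !mulr_suml -big_split.
  by [].
rewrite exchange_big; apply: eq_bigr => j _.
rewrite mxE /cdot !raddf_sum !mulr_sumr -big_split; apply: eq_bigr => i _ /=.
by rewrite !mxE; case: (a i j) (v j 0) (w i 0) => [a1 a2] [b1 b2] [c1 c2] /=; ring.
Qed.

Definition entry_sum a : R := \sum_i \sum_j cmod (a i j).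

Lemma entry_sum_ge0 a : 0 <= entry_sum a.
Proof. by do 2!apply: sumr_ge0 => ? _; exact: cmod_ge0. Qed.

Lemma nrm0 : nrm 0 = 0.
Proof. by rewrite /nrm -(scale0r 0) (rdotZl 0) mul0r sqrtr0. Qed.

Lemma nrm_delta c i : nrm (c *: delta_mx i 0) = cmod c.
Proof.
rewrite nrmZ /nrm /rdot (bigD1 i)//= big1 => [|j ji].
  by rewrite mxE !eqxx addr0 /cdot /= mulr1 mulr0 addr0 sqrtr1 mulr1.
by rewrite mxE (negbTE ji) /cdot /= !mulr0 addr0.
Qed.

Lemma nrm_sum (I : finType) (f : I -> 'cV_n) : nrm (\sum_i f i) <= \sum_i nrm (f i).
Proof.
elim/big_ind2: _ => [|v x w y vx wy|//]; first by rewrite nrm0.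
by apply: le_trans (nrmD _ _) _; exact: lerD.
Qed.

Lemma nrm_mul_le a v : nrm (a *m v) <= entry_sum a * nrm v.
Proof.
rewrite {1}[a]matrix_sum_delta mulmx_suml (le_trans (nrm_sum _))// /entry_sum mulr_suml.
apply: ler_sum => i _; rewrite mulmx_suml (le_trans (nrm_sum _))// mulr_suml.
apply: ler_sum => j _; rewrite -scalemxAl.
have -> : delta_mx i j *m v = v j 0 *: delta_mx i 0.
  apply/matrixP => k l; rewrite !mxE (bigD1 j)//= big1 ?addr0.
    by rewrite !mxE (ord1 l) eqxx !andbT mulrC.
  by move=> m mj; rewrite !mxE (negbTE mj) andbF mul0r.
by rewrite nrmZ nrm_delta ler_wpM2l ?cmod_ge0// entry_le.
Qed.

End Euclid.

Section OperatorNorm.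
Variables (R : realType) (n : nat).
Implicit Types (v w : 'cV[R[i]]_n) (a b : 'M[R[i]]_n).

Definition opnorm a : R := sup [set nrm (a *m v) | v in [set v | nrm v <= 1]].

Lemma opnorm_has_sup a : has_sup [set nrm (a *m v) | v in [set v | nrm v <= 1]].
Proof.
split; first by exists (nrm (a *m 0)), 0 => //=; rewrite nrm0.
exists (entry_sum a) => _ [v /= v1 <-]; apply: le_trans (nrm_mul_le a v) _.
by rewrite ler_piMr// entry_sum_ge0.
Qed.

Lemma opnorm_ge0 a : 0 <= opnorm a.
Proof.
apply: (@le_trans _ _ (nrm (a *m 0))); first exact: nrm_ge0.
by apply: sup_upper_bound (opnorm_has_sup a) _ _; exists 0 => //=; rewrite nrm0.
Qed.

Lemma opnorm_mul a v : nrm (a *m v) <= opnorm a * nrm v.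
Proof.
have [v0|v0] := eqVneq (nrm v) 0.
  by rewrite v0 (nrm_eq0 v0) mulmx0 nrm0 mulr0.
have vp : 0 < nrm v by rewrite lt_neqAle eq_sym v0 nrm_ge0.
have cV r : 0 <= r -> cmod r%:C%C = r.
  by move=> r0; rewrite /cmod normc_def /= expr0n addr0 sqrtr_sqr ger0_norm.
have V0 : 0 <= (nrm v)^-1 by rewrite invr_ge0 ltW.
have : nrm (a *m ((nrm v)^-1%:C%C *: v)) <= opnorm a.
  apply: sup_upper_bound (opnorm_has_sup a) _ _; eexists; last reflexivity.
  by rewrite /= nrmZ cV// mulVf.
by rewrite -scalemxAr nrmZ cV// mulrC ler_pdivrMr.
Qed.

Lemma opnorm_le a (c : R) : 0 <= c ->
  (forall v, nrm (a *m v) <= c * nrm v) -> opnorm a <= c.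
Proof.
move=> c0 h; apply: ge_sup; first exact: (opnorm_has_sup a).1.
move=> _ [v /= v1 <-]; apply: le_trans (h v) _.
by rewrite ler_piMr.
Qed.

Lemma opnorm_le_entry_sum a : opnorm a <= entry_sum a.
Proof. by apply: opnorm_le (entry_sum_ge0 a) _ => v; exact: nrm_mul_le. Qed.

Lemma entry_le_opnorm a i j : cmod (a i j) <= opnorm a.
Proof.
have d1 : nrm (delta_mx j 0 : 'cV[R[i]]_n) = 1.
  by rewrite -(scale1r (delta_mx j 0)) nrm_delta /cmod normr1.
have := opnorm_mul a (delta_mx j 0); rewrite d1 mulr1; apply: le_trans.
by have := entry_le (a *m delta_mx j 0) i; rewrite -colE mxE.
Qed.

Lemma opnorm_eq0 a : opnorm a = 0 -> a = 0.
Proof.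
move=> a0; apply/matrixP => i j; rewrite mxE; apply/eqP.
have := entry_le_opnorm a i j; rewrite a0; apply: contraTT => /cmod_gt0.
by rewrite -ltNge.
Qed.

Lemma opnormD a b : opnorm (a + b) <= opnorm a + opnorm b.
Proof.
apply: opnorm_le => [|v]; first by rewrite addr_ge0 ?opnorm_ge0.
by rewrite mulmxDl (le_trans (nrmD _ _))// mulrDl lerD// opnorm_mul.
Qed.

Lemma opnormM a b : opnorm (a *m b) <= opnorm a * opnorm b.
Proof.
apply: opnorm_le => [|v]; first by rewrite mulr_ge0 ?opnorm_ge0.
rewrite -mulmxA (le_trans (opnorm_mul _ _))// -mulrA ler_wpM2l ?opnorm_ge0//.
exact: opnorm_mul.
Qed.

Lemma opnormZ c a : opnorm (c *: a) = cmod c * opnorm a.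
Proof.
have le d b : opnorm (d *: b) <= cmod d * opnorm b.
  apply: opnorm_le => [|v]; first by rewrite mulr_ge0 ?cmod_ge0 ?opnorm_ge0.
  by rewrite -scalemxAl nrmZ -mulrA ler_wpM2l ?cmod_ge0// opnorm_mul.
apply/eqP; rewrite eq_le le /=.
have [->|c0] := eqVneq c 0.
  by rewrite /cmod normr0 mul0r opnorm_ge0.
have := le c^-1 (c *: a); rewrite scalerA mulVf// scale1r => h.
rewrite -(ler_pM2l (_ : 0 < cmod c^-1)) ?cmod_gt0 ?invr_eq0//.
by rewrite mulrA cmodV// mul1r.
Qed.

(** |a v|^2 = <v, a^{star} a v>. *)
Lemma opnorm_sqr_le a : opnorm a ^+ 2 <= opnorm (ctmx a *m a).
Proof.
have h0 := opnorm_ge0 (ctmx a *m a).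
rewrite -[leRHS]sqr_sqrtr// ler_sqr ?nnegrE ?opnorm_ge0 ?sqrtr_ge0//.
apply: opnorm_le => [|v]; first exact: sqrtr_ge0.
rewrite -ler_sqr ?nnegrE ?mulr_ge0 ?nrm_ge0 ?sqrtr_ge0// exprMn.
rewrite [Num.sqrt (opnorm _) ^+ 2]sqr_sqrtr//.
rewrite nrm_sqr rdot_ctmx mulmxA (le_trans (rdot_le _ _))//.
by rewrite expr2 mulrCA ler_wpM2l ?nrm_ge0// opnorm_mul.
Qed.

Lemma opnorm_ctmx_le a : opnorm a <= opnorm (ctmx a).
Proof.
have [a0|a0] := eqVneq (opnorm a) 0; first by rewrite a0 opnorm_ge0.
have ap : 0 < opnorm a by rewrite lt_neqAle eq_sym a0 opnorm_ge0.
rewrite -(ler_pM2r ap) -expr2; exact: le_trans (opnorm_sqr_le a) (opnormM _ _).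
Qed.

(** The preceding lemma gives |a| <= |a^{star}|, for a and for its adjoint, hence
    equality. *)
Lemma opnorm_ctmx_mul a : opnorm (ctmx a *m a) = opnorm a ^+ 2.
Proof.
apply/eqP; rewrite eq_le opnorm_sqr_le andbT (le_trans (opnormM _ _))// expr2.
rewrite ler_wpM2r ?opnorm_ge0//.
by have := opnorm_ctmx_le (ctmx a); rewrite ctmxK.
Qed.

Lemma ctmxD a b : ctmx (a + b) = ctmx a + ctmx b.
Proof. by apply/matrixP => i j; rewrite !mxE rmorphD. Qed.

Lemma ctmxZ (c : R[i]) a : ctmx (c *: a) = conjc c *: ctmx a.
Proof. by apply/matrixP => i j; rewrite !mxE rmorphM. Qed.

Lemma ctmxM a b : ctmx (a *m b) = ctmx b *m ctmx a.
Proof. by rewrite /ctmx map_mxM trmx_mul. Qed.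

(** The norm dominates the entries and is dominated by their sum, so that
    convergence is entrywise. *)
Lemma opnorm_complete (u : nat -> 'M[R[i]]_n) :
  (forall e : R, 0 < e ->
     exists N, forall k l, (N <= k)%N -> (N <= l)%N -> opnorm (u k - u l) < e) ->
  exists a, opnorm (u k - a) @[k --> \oo] --> (0 : R).
Proof.
move=> cu.
have cv (f : R[i] -> R) : (forall c d, f (c - d) = f c - f d) ->
    (forall c, `|f c| <= cmod c) -> forall i j, cvgn (fun k => f (u k i j)).
  move=> fB fc i j; apply: cauchy_cvg; apply: cauchy_exP => e e0.
  have [N hN] := cu e e0; exists (f (u N i j)); exists N => // k /= Nk.
  rewrite /ball /= -fB (le_lt_trans _ (hN _ _ (leqnn N) Nk))//.
  rewrite (le_trans (fc _))//; have := entry_le_opnorm (u N - u k) i j.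
  by rewrite !mxE.
have reB (c d : R[i]) : complex.Re (c - d) = complex.Re c - complex.Re d by rewrite raddfB.
have imB (c d : R[i]) : complex.Im (c - d) = complex.Im c - complex.Im d by rewrite raddfB.
have cre := cv _ reB (@Re_le_cmod R); have cim := cv _ imB (@Im_le_cmod R).
pose lre i j := limn (fun k => complex.Re (u k i j)).
pose lim i j := limn (fun k => complex.Im (u k i j)).
exists (\matrix_(i, j) (lre i j +i* lim i j)%C).
pose g k := \sum_i \sum_j (`|complex.Re (u k i j) - lre i j| + `|complex.Im (u k i j) - lim i j|).
suff g0 : g k @[k --> \oo] --> (0 : R).
  refine (squeeze_cvgr (f := cst 0) _ (cvg_cst _) g0).
  apply: nearW => k /=; rewrite opnorm_ge0 (le_trans (opnorm_le_entry_sum _))//.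
  apply: ler_sum => i _; apply: ler_sum => j _; apply: le_trans (cmod_le _) _.
  by rewrite !mxE reB imB.
have z : \sum_(i < n) \sum_(j < n) (0 + 0) = 0 :> R.
  by do 2!(rewrite big1 // => ? _); rewrite addr0.
rewrite -z; apply: cvg_big => [|i _]; first exact: add_continuous.
apply: cvg_big => [|j _]; first exact: add_continuous.
have d0 (h : nat -> R) : cvgn h -> `|h k - limn h| @[k --> \oo] --> 0.
  by move=> ch; apply/norm_cvg0P/subr_cvg0.
by apply: cvgD; apply: d0; [exact: cre | exact: cim].
Qed.

End OperatorNorm.

Section MatrixAlgebra.
Variables (R : realType) (n : nat).

HB.instance Definition _ := @isCStarAlgebra.Build R 'M[R[i]]_n.+1
  (@ctmx R n.+1) (@opnorm R n.+1) (@ctmxK R n.+1) (@ctmxD R n.+1) (@ctmxZ R n.+1)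
  (@ctmxM R n.+1) (@opnorm_eq0 R n.+1) (@opnormD R n.+1) (@opnormZ R n.+1)
  (@opnormM R n.+1) (@opnorm_ctmx_mul R n.+1) (@opnorm_complete R n.+1).

Definition matrix_cstar : cstarAlgType R := 'M[R[i]]_n.+1.

Lemma matrix_finite_dimensional : finite_dimensional matrix_cstar.
Proof.
exists #|{: 'I_n.+1 * 'I_n.+1}|, (fun k => delta_mx (enum_val k).1 (enum_val k).2).
move=> a; exists (fun k => (a : 'M[R[i]]_n.+1) (enum_val k).1 (enum_val k).2).
rewrite [LHS](matrix_sum_delta (a : 'M[R[i]]_n.+1)) pair_bigA /=.
rewrite (reindex (@enum_val {: 'I_n.+1 * 'I_n.+1} predT))//=.
exact: (onW_bij _ (enum_val_bij _)).
Qed.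

Definition diag_state (d : 'I_n.+1 -> R) (a : matrix_cstar) : R[i] :=
  \sum_i (d i)%:C%C * (a : 'M[R[i]]_n.+1) i i.

Lemma diag_state_linear d : linear_for *%R (diag_state d).
Proof.
move=> c a b; rewrite /diag_state mulr_sumr -big_split; apply: eq_bigr => i _.
by rewrite !mxE mulrDr mulrCA.
Qed.

HB.instance Definition _ d :=
  GRing.isLinear.Build R[i] matrix_cstar R[i] *%R (diag_state d) (diag_state_linear d).

Lemma diag_state_state (d : 'I_n.+1 -> R) : (forall i, 0 <= d i) -> \sum_i d i = 1 ->
  is_state (diag_state d).
Proof.
move=> d0 d1; split.
  rewrite /= /diag_state -[RHS](rmorph1 (real_complex R)) -d1 rmorph_sum.
  by apply: eq_bigr => i _; rewrite mxE eqxx mulr1.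
move=> a; apply: sumr_ge0 => i _; apply: mulr_ge0; first by rewrite lecR.
rewrite mxE; apply: sumr_ge0 => j _; rewrite !mxE mulrC.
by case: (a j i) => x y; rewrite lecE /=; apply/andP; split; [apply/eqP|]; nra.
Qed.

End MatrixAlgebra.

(** * Realization in dimension twelve *)

Section Gram.
Variable R : realType.

Definition dot3 (v w : R * R * R) : R :=
  v.1.1 * w.1.1 + v.1.2 * w.1.2 + v.2 * w.2.

(** Cholesky factorization. The second pivot s vanishes when x = 1 or x = -1, in
    which case positivity forces z = x y. *)
Lemma gram1 (x y z : R) : psd3 1 x y z -> exists v1 v2 v3,
  [/\ dot3 v1 v1 = 1, dot3 v2 v2 = 1 & dot3 v3 v3 = 1] /\
  [/\ dot3 v1 v2 = x, dot3 v1 v3 = y & dot3 v2 v3 = z].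
Proof.
move=> P; have [_ x1 y1 z1] := psd3_bound P.
have sq1 (t : R) : `|t| <= 1 -> 0 <= 1 - t ^+ 2.
  by move=> t1; rewrite subr_ge0 -real_normK ?num_real// expr_le1.
pose s := Num.sqrt (1 - x ^+ 2).
have sE : s ^+ 2 = 1 - x ^+ 2 by rewrite sqr_sqrtr// sq1.
have [s0|s0] := eqVneq s 0.
  have xx : x ^+ 2 = 1 by move: sE; rewrite s0 expr0n /=; lra.
  have zE : z = x * y.
    have h b : 0 <= b ^+ 2 + 2 * b * (z - x * y).
      have := P (- x) 1 b; have -> : (- x) ^+ 2 = 1 by rewrite sqrrN xx.
      have -> : - x * 1 * x = - 1 by rewrite mulr1 mulNr -expr2 xx.
      by lra.
    have := h (- (z - x * y)) => h'.
    have : (z - x * y) ^+ 2 <= 0 by lra.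
    by rewrite real_exprn_even_le0 ?num_real //= subr_eq0 => /eqP.
  exists (1, 0, 0), (x, 0, 0), (y, 0, Num.sqrt (1 - y ^+ 2)).
  rewrite /dot3 /= -!expr2 sqr_sqrtr ?sq1// xx zE.
  by split; split; ring.
have s2 : 0 < 1 - x ^+ 2 by rewrite -sE lt_neqAle sqr_ge0 andbT eq_sym sqrf_eq0.
pose c := (z - x * y) / s.
have det : 0 <= 1 - y ^+ 2 - c ^+ 2.
  have -> : 1 - y ^+ 2 - c ^+ 2 =
      (1 + 2 * x * y * z - x ^+ 2 - y ^+ 2 - z ^+ 2) / (1 - x ^+ 2).
    rewrite /c expr_div_n sE; field; by rewrite gt_eqF.
  rewrite divr_ge0 ?(ltW s2)// -(pmulr_rge0 _ s2).
  by have := P (- (y - x * z)) (- (z - x * y)) (1 - x ^+ 2); lra.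
exists (1, 0, 0), (x, s, 0), (y, c, Num.sqrt (1 - y ^+ 2 - c ^+ 2)).
rewrite /dot3 /= -!expr2 sE sqr_sqrtr//.
have -> : s * c = z - x * y by rewrite /c mulrC divfK.
by split; split; ring.
Qed.

Lemma gram3 (q x y z : R) : psd3 q x y z -> exists v1 v2 v3,
  [/\ dot3 v1 v1 = 1, dot3 v2 v2 = 1 & dot3 v3 v3 = 1] /\
  [/\ q * dot3 v1 v2 = x, q * dot3 v1 v3 = y & q * dot3 v2 v3 = z].
Proof.
move=> P; have [q0 x0 y0 z0] := psd3_bound P.
have [qz|qn] := eqVneq q 0.
  have z' (t : R) : `|t| <= q -> t = 0 by rewrite qz normr_le0 => /eqP.
  exists (1, 0, 0), (1, 0, 0), (1, 0, 0).
  rewrite qz (z' _ x0) (z' _ y0) (z' _ z0) /dot3 /= !mul0r.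
  by split; split; ring.
have qp : 0 < q by rewrite lt_neqAle eq_sym qn.
have P1 : psd3 1 (x / q) (y / q) (z / q).
  move=> b1 b2 b3; rewrite -(pmulr_rge0 _ qp).
  have -> : q * (1 * (b1 ^+ 2 + b2 ^+ 2 + b3 ^+ 2) +
     2 * (b1 * b2 * (x / q) + b1 * b3 * (y / q) + b2 * b3 * (z / q))) =
    q * (b1 ^+ 2 + b2 ^+ 2 + b3 ^+ 2) +
     2 * (b1 * b2 * x + b1 * b3 * y + b2 * b3 * z) by field.
  exact: P.
have [v1 [v2 [v3 [h [e1 e2 e3]]]]] := gram1 P1; exists v1, v2, v3; split=> //.
by rewrite e1 e2 e3; split; rewrite mulrC divfK.
Qed.

End Gram.

Section Quaternion.
Variable T : comNzRingType.
Implicit Types a b c : T.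

Definition mx4 (rows : seq (seq T)) : 'M[T]_4 :=
  \matrix_(i, j) nth 0 (nth [::] rows i) j.

(** Matrices of left and right multiplication by a i + b j + c k in the basis
    1, i, j, k of the quaternions. *)
Definition quat_l a b c : 'M[T]_4 := mx4
  [:: [:: 0; - a; - b; - c]; [:: a; 0; - c; b]; [:: b; c; 0; - a]; [:: c; - b; a; 0]].

Definition quat_r a b c : 'M[T]_4 := mx4
  [:: [:: 0; - a; - b; - c]; [:: a; 0; c; - b]; [:: b; - c; 0; a]; [:: c; b; - a; 0]].

Lemma quat_l_sqr a b c : quat_l a b c *m quat_l a b c = - (a ^+ 2 + b ^+ 2 + c ^+ 2)%:M.
Proof.
apply/matrixP => -[[|[|[|[|//]]]] ?] -[[|[|[|[|//]]]] ?];
  by rewrite !mxE !big_ord_recl big_ord0 !mxE /=; ring.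
Qed.

Lemma quat_r_sqr a b c : quat_r a b c *m quat_r a b c = - (a ^+ 2 + b ^+ 2 + c ^+ 2)%:M.
Proof.
apply/matrixP => -[[|[|[|[|//]]]] ?] -[[|[|[|[|//]]]] ?];
  by rewrite !mxE !big_ord_recl big_ord0 !mxE /=; ring.
Qed.

(** Associativity of the quaternions. *)
Lemma quat_comm a b c a' b' c' :
  quat_l a b c *m quat_r a' b' c' = quat_r a' b' c' *m quat_l a b c.
Proof.
apply/matrixP => -[[|[|[|[|//]]]] ?] -[[|[|[|[|//]]]] ?];
  by rewrite !mxE !big_ord_recl !big_ord0 !mxE /=; ring.
Qed.

(** The real part of the product of two imaginary quaternions. *)
Lemma quat_lr00 a b c a' b' c' :
  (quat_l a b c *m quat_r a' b' c') 0 0 = - (a * a' + b * b' + c * c').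
Proof. by rewrite !mxE !big_ord_recl big_ord0 !mxE /=; ring. Qed.

Lemma quat_l_tr a b c : (quat_l a b c)^T = - quat_l a b c.
Proof.
by apply/matrixP => -[[|[|[|[|//]]]] ?] -[[|[|[|[|//]]]] ?];
  rewrite !mxE /= ?opprK ?oppr0.
Qed.

Lemma quat_r_tr a b c : (quat_r a b c)^T = - quat_r a b c.
Proof.
by apply/matrixP => -[[|[|[|[|//]]]] ?] -[[|[|[|[|//]]]] ?];
  rewrite !mxE /= ?opprK ?oppr0.
Qed.

End Quaternion.

Lemma quat_l_conj (R : realType) (a b c : R) :
  map_mx conjc (quat_l a%:C%C b%:C%C c%:C%C) = quat_l a%:C%C b%:C%C c%:C%C.
Proof.
by apply/matrixP => -[[|[|[|[|//]]]] ?] -[[|[|[|[|//]]]] ?];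
  rewrite !mxE /=; apply/eqP; rewrite eq_complex /= ?oppr0 !eqxx.
Qed.

Lemma quat_r_conj (R : realType) (a b c : R) :
  map_mx conjc (quat_r a%:C%C b%:C%C c%:C%C) = quat_r a%:C%C b%:C%C c%:C%C.
Proof.
by apply/matrixP => -[[|[|[|[|//]]]] ?] -[[|[|[|[|//]]]] ?];
  rewrite !mxE /=; apply/eqP; rewrite eq_complex /= ?oppr0 !eqxx.
Qed.

Section Reflections.
Variables (R : realType) (A : cstarAlgType R).
Implicit Types (u w : A).

Definition spectral_proj (u : A) (i : 'I_2) : A := rscale 2^-1 (1 + rscale (osign R i) u).

Lemma spectral_proj_pvm u : reflection u -> is_pvm (spectral_proj u).
Proof.
move=> [su uu]; split=> [i|].
  split; first by rewrite /spectral_proj star_rscale starD star1 star_rscale su.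
  have ss : osign R i * osign R i = 1 by rewrite /osign; case: (i == ord0); ring.
  rewrite /spectral_proj expr2 rscaleAl rscaleAr mulrDl mul1r mulrDr mulr1.
  rewrite [rscale _ u * _]rscaleAl [u * _]rscaleAr uu [rscale _ (rscale _ 1)]rscaleA ss rscale1.
  by rewrite [rscale (osign R i) u + 1]addrC rscale_half.
rewrite big_ord_recl big_ord1 /spectral_proj -scalerDr /osign /= rscale1 rscaleN1.
rewrite addrACA subrr addr0.
exact: rscale_half.
Qed.

Lemma moment_corr_realized (phi : {scalar A}) (u w : 'I_3 -> A) a c :
  (forall x, reflection (u x)) -> (forall y, reflection (w y)) ->
  (forall x y, u x * w y = w y * u x) -> is_state phi ->
  (forall x, phi (u x) = (a x)%:C%C) -> (forall y, phi (w y) = (a y)%:C%C) ->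
  (forall x y, phi (u x * w y) = (c x y)%:C%C) ->
  realized_in A (moment_corr a c).
Proof.
move=> U W uw S pu param_weight puw.
exists (fun x => spectral_proj (u x)), (fun y => spectral_proj (w y)), phi; split=> //.
- by move=> x; exact: spectral_proj_pvm.
- by move=> y; exact: spectral_proj_pvm.
- move=> x y i j; rewrite /spectral_proj !rscaleAl !rscaleAr !mulrDl !mulrDr !mul1r !mulr1.
  by rewrite !rscaleAl !rscaleAr uw !rscaleA [osign R j * _]mulrC addrACA [2^-1 * _]mulrC.
- move=> x y i j; rewrite /spectral_proj rscaleAl rscaleAr rscaleA.
  rewrite mulrDl mul1r mulrDr mulr1 rscaleAl rscaleAr.
  rewrite !(linearZ, linearD) /= pu param_weight puw S.1.
  by rewrite /moment_corr; apply/eqP; rewrite eq_complex /=; apply/andP; split; apply/eqP; field.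
Qed.

End Reflections.

Section BlockModel.
Variable R : realType.

(** The eight sign patterns, numbered by their binary digits. *)
Definition atom1 (k : 'I_8) := odd k.
Definition atom2 (k : 'I_8) := odd k./2.
Definition atom3 (k : 'I_8) := odd k./2./2.

Lemma atom_sum_ord (w : bool -> bool -> bool -> R) f :
  \sum_k w (atom1 k) (atom2 k) (atom3 k) * f (atom1 k) (atom2 k) (atom3 k) = atom_sum w f.
Proof. by rewrite /atom_sum !big_bool !big_ord_recl big_ord0 /=; ring. Qed.

(** A sign for each deterministic point, followed by a reflection of C^4. *)
Definition block_obs (s : 'I_8 -> R) (X : 'M[R[i]]_4) : 'M[R[i]]_(8 + 4) :=
  block_mx (diag_mx (\row_k (s k)%:C%C)) 0 0 X.

Lemma block_obs_mul s X s' X' :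
  block_obs s X *m block_obs s' X' = block_obs (fun k => s k * s' k) (X *m X').
Proof.
rewrite /block_obs mulmx_block !(mulmx0, mul0mx) !(addr0, add0r) mulmx_diag.
by congr block_mx; congr diag_mx; apply/rowP => k; rewrite !mxE rmorphM.
Qed.

Lemma block_obs1 s : (forall k, s k = 1) -> block_obs s 1%:M = 1%:M.
Proof.
move=> s1; rewrite /block_obs [RHS]scalar_mx_block; congr block_mx.
rewrite -diag_const_mx; congr diag_mx; apply/rowP => k; rewrite !mxE s1.
by rewrite rmorph1.
Qed.

Lemma block_obs_ctmx s X : ctmx (block_obs s X) = block_obs s (ctmx X).
Proof.
rewrite /ctmx /block_obs map_block_mx tr_block_mx !map_mx0 !trmx0; congr block_mx.
rewrite map_diag_mx tr_diag_mx; congr diag_mx; apply/rowP => k; rewrite !mxE /=.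
by rewrite oppr0.
Qed.

(** The state is the mixture of the eight deterministic points and the vector state
    at the quaternion 1, the first basis vector of C^4. *)
Definition weight (w : bool -> bool -> bool -> R) (q : R) (i : 'I_(8 + 4)) : R :=
  match fintype.split i with
  | inl k => w (atom1 k) (atom2 k) (atom3 k)
  | inr k => if k == ord0 then q else 0
  end.

Lemma weight_sum w q (f : 'I_(8 + 4) -> R[i]) :
  \sum_i (weight w q i)%:C%C * f i =
  \sum_k (w (atom1 k) (atom2 k) (atom3 k))%:C%C * f (lshift 4 k) + q%:C%C * f (rshift 8 ord0).
Proof.
rewrite big_split_ord /=; congr (_ + _).
  by apply: eq_bigr => k _; rewrite /weight (unsplitK (inl k)).
rewrite (bigD1 ord0)//= big1 => [|k /negbTE k0].
  by rewrite addr0 /weight (unsplitK (inr ord0)).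
by rewrite /weight (unsplitK (inr k)) k0 mul0r.
Qed.

Lemma weight_ge0 w q i : (forall s1 s2 s3, 0 <= w s1 s2 s3) -> 0 <= q -> 0 <= weight w q i.
Proof. by move=> w0 q0; rewrite /weight; case: fintype.split => // k; case: ifP. Qed.

Lemma weight_total w q : \sum_i weight w q i = atom_sum w (fun _ _ _ => 1) + q.
Proof.
apply: (@complexI R); rewrite rmorph_sum rmorphD -atom_sum_ord rmorph_sum /=.
transitivity (\sum_i (weight w q i)%:C%C * 1 : R[i]).
  by apply: eq_bigr => i _; rewrite mulr1.
rewrite (weight_sum w q (fun=> 1)) mulr1; congr (_ + _).
by apply: eq_bigr => k _; rewrite !mulr1.
Qed.

Lemma weight_obs w q s (X : 'M[R[i]]_4) :
  \sum_i (weight w q i)%:C%C * block_obs s X i i =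
  (\sum_k w (atom1 k) (atom2 k) (atom3 k) * s k)%:C%C + q%:C%C * X ord0 ord0.
Proof.
rewrite weight_sum /block_obs block_mxEdr rmorph_sum; congr (_ + _).
by apply: eq_bigr => k _; rewrite block_mxEul !mxE eqxx mulr1n rmorphM.
Qed.

Definition atoms (x : 'I_3) (k : 'I_8) : R :=
  bsign R (tri (atom1 k) (atom2 k) (atom3 k) x).

(** Multiplication by an imaginary unit quaternion is antisymmetric with square -1;
    the factor i makes it a reflection. *)
Definition spin (L : R[i] -> R[i] -> R[i] -> 'M[R[i]]_4) (v : R * R * R) : 'M[R[i]]_4 :=
  'i%C *: L v.1.1%:C%C v.1.2%:C%C v.2%:C%C.

Lemma sync_set_sub_C_q_s : @sync_set R `<=` C_q_s R 3 2.
Proof.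
move=> p [a1 [a2 [a3 [c12 [c13 [c23 [C ->]]]]]]].
have [w [q [n12 [n13 [n23 [w0 P [m [e1 e2 e3] e12 e13 e23]]]]]]] := C.
have [v1 [v2 [v3 [[d1 d2 d3] [d12 d13 d23]]]]] := gram3 P.
have [q0 _ _ _] := psd3_bound P.
pose v := tri v1 v2 v3.
have vv x : dot3 (v x) (v x) = 1 by rewrite /v /tri; case: (x == ord0) => //; case: (x == ord_max).
pose A : cstarAlgType R := matrix_cstar R 11.
pose u x : A := block_obs (atoms x) (spin (@quat_l _) (v x)).
pose u' y : A := block_obs (atoms y) (spin (@quat_r _) (v y)).
have ss x k : atoms x k * atoms x k = 1 by rewrite /atoms /bsign; case: (tri _ _ _ _); ring.
have ci : conjc 'i%C = - 'i%C :> R[i] by apply/eqP; rewrite eq_complex /= oppr0 !eqxx.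
have refl (L : R[i] -> R[i] -> R[i] -> 'M[R[i]]_4) x :
    (forall a b c, L a b c *m L a b c = - (a ^+ 2 + b ^+ 2 + c ^+ 2)%:M) ->
    (forall a b c : R, ctmx (L a%:C%C b%:C%C c%:C%C) = - L a%:C%C b%:C%C c%:C%C) ->
    reflection (block_obs (atoms x) (spin L (v x)) : A).
  move=> LL La; split.
    rewrite /star /= block_obs_ctmx; congr (block_obs _ _ : A).
    by rewrite /spin ctmxZ La ci scalerN scaleNr opprK.
  apply: (etrans (block_obs_mul _ _ _ _)).
  rewrite -[RHS](@block_obs1 (fun k => atoms x k * atoms x k)) //.
  congr block_obs; rewrite /spin -scalemxAl -scalemxAr scalerA LL.
  have -> : 'i%C * 'i%C = -1 :> R[i] by rewrite -expr2 sqr_i.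
  rewrite scaleN1r opprK -!rmorphXn -!rmorphD /=.
  by have := vv x; rewrite /dot3 -!expr2 => ->; rewrite rmorph1.
have U x : reflection (u x).
  apply: refl => [a b c|a b c]; first exact: quat_l_sqr.
  by rewrite /ctmx quat_l_conj quat_l_tr.
have U' y : reflection (u' y).
  apply: refl => [a b c|a b c]; first exact: quat_r_sqr.
  by rewrite /ctmx quat_r_conj quat_r_tr.
have comm x y : u x * u' y = u' y * u x.
  apply: (etrans (block_obs_mul _ _ _ _)); apply: esym.
  apply: (etrans (block_obs_mul _ _ _ _)).
  rewrite (_ : (fun k => atoms y k * atoms x k) = (fun k => atoms x k * atoms y k)).
    by rewrite /spin -!scalemxAl -!scalemxAr quat_comm.
  by apply/funext => k; rewrite mulrC.
have S : is_state (diag_state (weight w q) : A -> R[i]).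
  apply: diag_state_state => [i|]; first exact: weight_ge0.
  by rewrite weight_total -m.
have ph s X : diag_state (weight w q) (block_obs s X : A) =
    (\sum_k w (atom1 k) (atom2 k) (atom3 k) * s k)%:C%C + q%:C%C * X ord0 ord0.
  exact: weight_obs.
have I x : [\/ x = ord0, x = Ordinal (isT : (1 < 3)%N) | x = ord_max].
  by case: x => [[|[|[|//]]]] ?; [apply: Or31|apply: Or32|apply: Or33]; apply: val_inj.
have one x : \sum_k w (atom1 k) (atom2 k) (atom3 k) * atoms x k = tri a1 a2 a3 x.
  rewrite /tri e1 e2 e3 -!atom_sum_ord.
  by case: (I x) => ->; apply: eq_bigr => k _.
have two x y : \sum_k w (atom1 k) (atom2 k) (atom3 k) * (atoms x k * atoms y k)
    + q * dot3 (v x) (v y) = sym3 c12 c13 c23 x y.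
  have dC a b : dot3 a b = dot3 b a by rewrite /dot3; ring.
  pose T x y := \sum_k w (atom1 k) (atom2 k) (atom3 k) * (atoms x k * atoms y k)
    + q * dot3 (v x) (v y).
  have TC x' y' : T x' y' = T y' x'.
    by rewrite /T dC; congr (_ + _); apply: eq_bigr => k _; congr (_ * _); rewrite mulrC.
  have Tx x' : T x' x' = 1.
    rewrite /T vv mulr1 [RHS]m -(atom_sum_ord w (fun _ _ _ => 1)); congr (_ + _).
    by apply: eq_bigr => k _; rewrite ss.
  have T12 : T ord0 (Ordinal (isT : (1 < 3)%N)) = c12.
    by rewrite e12 -d12 -atom_sum_ord.
  have T13 : T ord0 ord_max = c13 by rewrite e13 -d13 -atom_sum_ord.
  have T23 : T (Ordinal (isT : (1 < 3)%N)) ord_max = c23.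
    by rewrite e23 -d23 -atom_sum_ord.
  rewrite -/(T x y); case: (I x) (I y) => -> [] ->; rewrite ?Tx ?T12 ?T13 ?T23 //.
  - by rewrite TC T12.
  - by rewrite TC T13.
  - by rewrite TC T23.
split.
  exists A; first exact: matrix_finite_dimensional.
  apply: (moment_corr_realized (phi := diag_state (weight w q)) U U' comm S).
  - by move=> x; apply: (etrans (ph _ _)); rewrite one /spin !mxE /= !mulr0 addr0.
  - by move=> x; apply: (etrans (ph _ _)); rewrite one /spin !mxE /= !mulr0 addr0.
  - move=> x y; rewrite [u x * u' y](block_obs_mul _ _ _ _); apply: (etrans (ph _ _)).
    rewrite /spin -scalemxAl -scalemxAr scalerA mxE.
    have -> : 'i%C * 'i%C = -1 :> R[i] by rewrite -expr2 sqr_i.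
    rewrite quat_lr00 mulN1r opprK -!rmorphM -!rmorphD -rmorphM -rmorphD; congr (_%:C%C).
    exact: two.
move=> x i j ij; rewrite /corr6 /moment_corr.
have -> : sym3 c12 c13 c23 x x = 1 by case: (I x) => ->.
have -> : osign R j = - osign R i.
  by rewrite /osign; case: i j ij => [[|[|//]]] ? [[|[|//]]] ? //= _; rewrite opprK.
have ii : osign R i * osign R i = 1 by rewrite /osign; case: (i == ord0); ring.
by rewrite mulrN ii; ring.
Qed.

End BlockModel.

(** * Conclusion *)

Theorem theorem4p8 (R : realType) :
  C_q_s R 3 2 = C_qc_s R 3 2 /\ closed (C_q_s R 3 2).
Proof.
have sub : C_q_s R 3 2 `<=` C_qc_s R 3 2.
  by move=> p [[A _ pA] sp]; split=> //; exists A.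
have E : C_q_s R 3 2 = @sync_set R.
  apply/seteqP; split; last exact: sync_set_sub_C_q_s.
  by move=> p /sub/C_qc_s_sub_sync_set.
split; last by rewrite E; exact: sync_set_closed.
apply/seteqP; split=> // p /C_qc_s_sub_sync_set; rewrite E; exact.
Qed.
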